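(* Let $T$ be one of the following operators on $\mathbb{R}^d$: a dyadic martingale transform, a Haar shift operator, or the dyadic maximal operator $\mathcal{M}_\mathscr{D}$. Then there exists $0<r<1$ such that for each $f\in L^\infty_c(\mathbb{R}^d)$ there is a sparse family $\mathcal{S}\subset\mathscr{D}$ (with sparseness parameter independent of $f$) such that $$Tf(x)\lesssim \sum_{Q\in\mathcal{S}} \mathsf{P}_Q^r(\mathcal{M}_Q f)\,\mathbf{1}_Q(x),\qquad x\in\mathbb{R}^d,$$ with implicit constant independent of $f$.
   Context: $\mathscr{D}$ is the standard dyadic grid on $\mathbb{R}^d$, $\mathscr{D}_k$ the dyadic cubes of side length $2^{-k}$, $\mathscr{D}(Q)$ the dyadic subcubes of $Q$ (including $Q$), $\mathscr{D}_\ell(Q)$ those with side length $2^{-\ell}\ell(Q)$, and $\langle f\rangle_Q=\frac1{|Q|}\int_Q f$. $\mathcal{M}_\mathscr{D} f(x)=\sup_{x\in Q\in\mathscr{D}}|\langle f\rangle_Q|$ and $\mathcal{M}_Q f(x)=\sup_{x\in R\in\mathscr{D}(Q)}|\langle f\rangle_R|$. For a set $\Omega$ of positive finite measure and measurable $g$, $\mathsf{P}^r_\Omega(g):=\inf\{\lambda\in\mathbb{R}: |\{x\in\Omega: g(x)>\lambda\}|\le r|\Omega|\}$. A family $\mathcal{S}$ of cubes is $\eta$-sparse ($0<\eta<1$) if for each $Q\in\mathcal{S}$ there is $E_Q\subset Q$ with $|E_Q|\ge\eta|Q|$ and the $E_Q$ pairwise disjoint. A dyadic martingale transform is $Tf=\sum_k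 \sigma_k\,(\mathsf{E}_kf-\mathsf{E}_{k-1}f)$ where $\mathsf{E}_kf=\sum_{Q\in\mathscr{D}_k}\langle f\rangle_Q\mathbf{1}_Q$ and each $\sigma_k$ is $\sigma(\mathscr{D}_{k-1})$-measurable with $\sup_k\|\sigma_k\|_\infty\le1$. Given a Haar basis $\{h_Q\}_{Q\in\mathscr{D}}$ of $L^2(\mathbb{R}^d)$ (each $h_Q$ supported on $Q$, constant on the dyadic children of $Q$, mean zero, $L^2$-normalized), a Haar shift of complexity $(t,s)$ is $\mathrm{Sh} f=\sum_{Q\in\mathscr{D}}\sum_{T\in\mathscr{D}_t(Q)}\sum_{S\in\mathscr{D}_s(Q)}\alpha^Q_{TS}\langle f,h_T\rangle h_S$ with $\sup_{Q,T,S}|\alpha^Q_{TS}|<\infty$. *)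

(* Defs.v *)
From HB Require Import structures.
From mathcomp Require Import all_boot all_order all_algebra.
From mathcomp Require Import all_classical all_reals all_analysis.
Set Implicit Arguments. Unset Strict Implicit. Unset Printing Implicit Defensive.
Import Order.TTheory GRing.Theory Num.Theory.
Local Open Scope classical_set_scope.
Local Open Scope ring_scope.

(* Points of R^d are d-tuples of reals, equipped with the product (Borel)
   sigma-algebra provided by MathComp-Analysis (measure_tuple_display). *)
Notation pt R d := (d.-tuple R).

(* A dyadic cube is encoded by (k, j) with k : int, j : d-tuple of ints; it is
   Q = prod_i [ j_i 2^-k, (j_i+1) 2^-k ), of side length 2^-k (so Q in D_k). *)
Definition dcube (d : nat) := (int * d.-tuple int)%type.

Definition cube_set (R : realType) (d : nat) (Q : dcube d) : set (pt R d) :=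
  [set x | forall i : 'I_d,
     (tnth Q.2 i)%:~R * (2 : R) ^ (- Q.1) <= tnth x i /\
     tnth x i < ((tnth Q.2 i) + 1)%:~R * (2 : R) ^ (- Q.1)].

Arguments cube_set R {d}.

Definition dcube_of (R : realType) (d : nat) (k : int) (x : pt R d) : dcube d :=
  (k, [tuple Num.floor ((2 : R) ^ k * tnth x i) | i < d]).

Definition subcube (d : nat) (Q : dcube d) (l : nat) (a : d.-tuple 'I_(2 ^ l)) :
  dcube d :=
  (Q.1 + l%:Z, [tuple tnth Q.2 i * (2%:Z ^+ l) + (nat_of_ord (tnth a i))%:Z | i < d]).

(* mu is the d-dimensional Lebesgue measure: it gives every half-open box its
   volume (this determines it uniquely on the Borel sets). *)
Definition is_lebesgue (R : realType) (d : nat)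
    (mu : {measure set (pt R d) -> \bar R}) : Prop :=
  forall a b : pt R d, (forall i, tnth a i <= tnth b i) ->
    mu [set x | forall i, tnth a i <= tnth x i /\ tnth x i < tnth b i] =
    (\prod_(i < d) (tnth b i - tnth a i))%:E.

Definition avg (R : realType) (d : nat) (mu : {measure set (pt R d) -> \bar R})
    (f : pt R d -> R) (Q : dcube d) : R :=
  Rintegral mu (cube_set R Q) f / fine (mu (cube_set R Q)).

Definition Ek (R : realType) (d : nat) (mu : {measure set (pt R d) -> \bar R})
    (f : pt R d -> R) (k : int) (x : pt R d) : R :=
  avg mu f (dcube_of k x).

Definition MD (R : realType) (d : nat) (mu : {measure set (pt R d) -> \bar R})
    (f : pt R d -> R) (x : pt R d) : \bar R :=
  ereal_sup [set (`|avg mu f Q|)%:E | Q in [set Q : dcube d | cube_set R Q x]].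

Definition MQ (R : realType) (d : nat) (mu : {measure set (pt R d) -> \bar R})
    (f : pt R d -> R) (Q : dcube d) (x : pt R d) : \bar R :=
  ereal_sup [set (`|avg mu f P|)%:E |
     P in [set P : dcube d | cube_set R P `<=` cube_set R Q /\ cube_set R P x]].

Definition Pquant (R : realType) (d : nat) (mu : {measure set (pt R d) -> \bar R})
    (r : R) (Om : set (pt R d)) (g : pt R d -> \bar R) : \bar R :=
  ereal_inf [set l%:E | l in [set l : R |
     (mu (Om `&` [set x | l%:E < g x]) <= r%:E * mu Om)%E]].

Definition sparse (R : realType) (d : nat) (mu : {measure set (pt R d) -> \bar R})
    (eta : R) (S : set (dcube d)) : Prop :=
  exists E : dcube d -> set (pt R d),
    (forall Q, S Q -> [/\ measurable (E Q), E Q `<=` cube_set R Q &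
                         (eta%:E * mu (cube_set R Q) <= mu (E Q))%E]) /\
    (forall Q Q', S Q -> S Q' -> Q <> Q' -> E Q `&` E Q' = set0).

Definition Linfc (R : realType) (d : nat) (f : pt R d -> R) : Prop :=
  [/\ measurable_fun setT f,
      exists M : R, forall x, `|f x| <= M &
      exists rho : R, forall x, (exists i, rho < `|tnth x i|) -> f x = 0].

Definition sparse_dominated (R : realType) (d : nat)
    (mu : {measure set (pt R d) -> \bar R})
    (T : (pt R d -> R) -> pt R d -> \bar R) : Prop :=
  exists r : R, 0 < r < 1 /\ exists eta : R, 0 < eta < 1 /\ exists C : R, 0 < C /\
    forall f, Linfc f -> exists S : set (dcube d), sparse mu eta S /\
      {ae mu, forall x, (T f x <=
         C%:E * \esum_(Q in S) (Pquant mu r (cube_set R Q) (MQ mu f Q) *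
                                (\1_(cube_set R Q) x)%:E))%E}.

(* sigma_k is sigma(D_{k-1})-measurable (constant on cubes of D_{k-1}), |sigma_k|<=1 *)
Definition mt_multiplier (R : realType) (d : nat) (sigma : int -> pt R d -> R) : Prop :=
  (forall k x y, dcube_of (k - 1) x = dcube_of (k - 1) y -> sigma k x = sigma k y) /\
  (forall k x, `|sigma k x| <= 1).

Definition mt_partial (R : realType) (d : nat) (mu : {measure set (pt R d) -> \bar R})
    (sigma : int -> pt R d -> R) (f : pt R d -> R) (x : pt R d) (N : nat) : R :=
  \sum_(i < (2 * N).+1)
     let k := (i%:Z - N%:Z)%R in sigma k x * (Ek mu f k x - Ek mu f (k - 1) x).

(* Tf(x) = the (a.e. existing) limit of partial sums, taken as limsup *)
Definition mart_transform (R : realType) (d : nat) (mu : {measure set (pt R d) -> \bar R})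
    (sigma : int -> pt R d -> R) (f : pt R d -> R) (x : pt R d) : \bar R :=
  limn_esup (fun N => (mt_partial mu sigma f x N)%:E).

Definition haar_system (R : realType) (d : nat) (mu : {measure set (pt R d) -> \bar R})
    (h : dcube d -> 'I_(2 ^ d).-1 -> pt R d -> R) : Prop :=
  forall Q e,
  [/\ measurable_fun setT (h Q e),
      forall x, ~ cube_set R Q x -> h Q e x = 0,
      forall (a : d.-tuple 'I_(2 ^ 1)) x y, cube_set R (subcube Q a) x ->
         cube_set R (subcube Q a) y -> h Q e x = h Q e y,
      Rintegral mu (cube_set R Q) (h Q e) = 0 &
      forall e', Rintegral mu setT (fun x => h Q e x * h Q e' x) = (e == e')%:R].

(* contribution of the cubes Q in D_k to Sh f(x): only the Q in D_k containing x
   can contribute, since h_S is supported in S subset Q. *)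
Definition shift_gen (R : realType) (d : nat) (mu : {measure set (pt R d) -> \bar R})
    (t s : nat) (h : dcube d -> 'I_(2 ^ d).-1 -> pt R d -> R)
    (alpha : dcube d -> dcube d -> dcube d -> 'I_(2 ^ d).-1 -> 'I_(2 ^ d).-1 -> R)
    (f : pt R d -> R) (k : int) (x : pt R d) : R :=
  let Q := dcube_of k x in
  \sum_(a : d.-tuple 'I_(2 ^ t)) \sum_(b : d.-tuple 'I_(2 ^ s))
  \sum_(e : 'I_(2 ^ d).-1) \sum_(e' : 'I_(2 ^ d).-1)
    alpha Q (subcube Q a) (subcube Q b) e e' *
    Rintegral mu setT (fun y => f y * h (subcube Q a) e y) *
    h (subcube Q b) e' x.

Definition shift_partial (R : realType) (d : nat) (mu : {measure set (pt R d) -> \bar R})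
    (t s : nat) h alpha (f : pt R d -> R) (x : pt R d) (N : nat) : R :=
  \sum_(i < (2 * N).+1) shift_gen mu t s h alpha f (i%:Z - N%:Z)%R x.

Definition haar_shift (R : realType) (d : nat) (mu : {measure set (pt R d) -> \bar R})
    (t s : nat) h alpha (f : pt R d -> R) (x : pt R d) : \bar R :=
  limn_esup (fun N => (shift_partial mu t s h alpha f x N)%:E).

(* Main.v *)
(** Let [lam Q] be the [r]-quantile of [MQ f] on [Q], with [r] tiny.  A martingale
    transform or a Haar shift is a sum over the cubes containing [x] of martingale
    differences whose squares are controlled by the oscillation of the averages of
    [f] a fixed number of generations below the cube.  Starting from [Q], stop at
    the maximal subcubes near which some average of [f] exceeds [lam Q], or where
    the partial sum of the operator starting at [Q] exceeds a large multiple of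
    [lam Q].  The first kind is rare by definition of the quantile, the second by
    the maximal inequality applied to an energy, the mean of the squared partial
    sum plus [K] times the mean of [(lam Q)^2 - <f>^2], which is a supermartingale
    as long as the averages of [f] stay below [lam Q].  Iterating gives a sparse
    family; between two consecutive selected cubes containing [x], the partial sums
    and the averages of [f] (hence the maximal operator) are at most a constant
    times [lam] of the larger one.  Since [r] is smaller than the proportion of any
    descendant of bounded generation, no jump of the operator at a stopping cube
    needs to be estimated separately. *)
Require Import Defs.
From HB Require Import structures.
From mathcomp Require Import all_boot all_order all_algebra.
From mathcomp Require Import all_classical all_reals all_analysis.
From mathcomp Require Import measurable_realfun.
From mathcomp Require Import ring lra zify.
Import Order.TTheory GRing.Theory Num.Theory.
Local Open Scope classical_set_scope.
Local Open Scope ring_scope.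

Set Implicit Arguments.
Unset Strict Implicit.
Unset Printing Implicit Defensive.

(** * Combinatorics of the dyadic grid *)

Section DyadicCubes.
Variables (R : realType) (d : nat).
Implicit Types (Q P : dcube d) (x y : d.-tuple R) (k : int).

Lemma two_exprz_gt0 k : 0 < (2 : R) ^ k.
Proof. by rewrite exprz_gt0. Qed.

Lemma floor_dyadic k (j : int) (z : R) :
  (j%:~R * 2 ^ (- k) <= z /\ z < (j + 1)%:~R * 2 ^ (- k)) <->
  Num.floor (2 ^ k * z) = j.
Proof.
have k0 := two_exprz_gt0 k.
rewrite -invr_expz ler_pdivrMr // ltr_pdivlMr // mulrC.
split=> [[h1 h2]|<-]; last by rewrite floor_le_tmp floorD1_gt.
by apply: floor_def; rewrite h1 h2.
Qed.

Lemma cube_setE Q x : cube_set R Q x <-> dcube_of Q.1 x = Q.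
Proof.
case: Q => k j; rewrite /cube_set /dcube_of /=; split => [h|[<-] i].
  congr pair; apply: eq_from_tnth => i; rewrite tnth_mktuple.
  exact/floor_dyadic.
by rewrite tnth_mktuple; apply/floor_dyadic.
Qed.

Lemma mem_dcube_of k x : cube_set R (dcube_of k x) x.
Proof. exact/cube_setE. Qed.

Lemma dcube_of_eq Q x : cube_set R Q x -> dcube_of Q.1 x = Q.
Proof. by move/cube_setE. Qed.

Lemma dcube_of_mem k x y : cube_set R (dcube_of k x) y ->
  dcube_of k y = dcube_of k x.
Proof. by move/dcube_of_eq. Qed.

Lemma cube_set_eq Q P x : Q.1 = P.1 -> cube_set R Q x -> cube_set R P x -> Q = P.
Proof. by move=> e /dcube_of_eq <- /dcube_of_eq <-; rewrite e. Qed.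

(** A canonical point of each cube: evaluating there turns a function constant on small cubes into a
    function of cubes. *)
Definition corner Q : d.-tuple R :=
  [tuple (tnth Q.2 i)%:~R * (2 : R) ^ (- Q.1) | i < d].

Lemma mem_corner Q : cube_set R Q (corner Q).
Proof.
move=> i; rewrite tnth_mktuple lexx ltr_pM2r ?two_exprz_gt0 //.
by rewrite ltr_int ltrDl ltr01.
Qed.

Lemma subcube_sub Q l (a : d.-tuple 'I_(2 ^ l)) :
  cube_set R (subcube Q a) `<=` cube_set R Q.
Proof.
move=> x h i; have {h} := h i; rewrite /subcube /= tnth_mktuple.
set j := tnth Q.2 i; set n := tnth a i.
have k0 := two_exprz_gt0 (- Q.1).
rewrite opprD expfzDr ?pnatr_eq0 // -(invr_expz 2 l%:Z) [2 ^ l%:Z]/(_ ^+ _) => -[h1 h2].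
have l0 : 0 < (2 : R) ^+ l by rewrite exprn_gt0.
rewrite -[j%:~R](mulfK (lt0r_neq0 l0)) -[(j + 1)%:~R](mulfK (lt0r_neq0 l0)).
have e : (2 : R) ^+ l = (2%:Z ^+ l)%:~R by rewrite rmorphXn.
split; [apply: le_trans h1|apply: lt_le_trans h2 _];
  rewrite (mulrC (2 ^ _)) !mulrA ler_pM2r // ler_pM2r ?invr_gt0 // e -rmorphM ler_int.
  by rewrite lerDl.
have := ltn_ord n; rewrite -(ltr_nat int) => nl.
rewrite mulrDl mul1r -addrA lerD2l.
by move: nl; rewrite natrX natz lezD1.
Qed.

Lemma subcube_cover Q l x : cube_set R Q x ->
  exists a : d.-tuple 'I_(2 ^ l), cube_set R (subcube Q a) x.
Proof.
move=> Qx.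
have l0 : 0 < (2 : R) ^+ l by rewrite exprn_gt0.
have e : (2 : R) ^+ l = (2%:Z ^+ l)%:~R by rewrite rmorphXn.
pose n i := Num.floor ((2 : R) ^ (Q.1 + l%:Z) * tnth x i).
have bd i : tnth Q.2 i * 2 ^+ l <= n i < (tnth Q.2 i + 1) * 2 ^+ l.
  have := floor_itv ((2 : R) ^ Q.1 * tnth x i).
  have /floor_dyadic -> := Qx i => jx.
  rewrite /n expfzDr ?pnatr_eq0 // [2 ^ l%:Z]/(_ ^+ _).
  rewrite floor_ge_int floor_lt_int !rmorphM /= -e mulrAC.
  by rewrite ler_pM2r // ltr_pM2r.
have bd' i : (absz (n i - tnth Q.2 i * 2 ^+ l)%R < 2 ^ l)%N.
  have /andP[h1 h2] := bd i.
  rewrite -(ltr_nat int) natrX !natz gez0_abs ?subr_ge0 //.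
  by rewrite ltrBlDr addrC -[X in _ + X]mul1r -mulrDl.
exists [tuple Ordinal (bd' i) | i < d].
apply/cube_setE; rewrite /dcube_of /subcube /=; congr pair.
apply: eq_from_tnth => i; rewrite !tnth_mktuple /= -/(n i).
have /andP[h1 h2] := bd i.
by rewrite gez0_abs ?subr_ge0 // addrC subrK.
Qed.

Lemma subcube_inj Q l : injective (@subcube d Q l).
Proof.
move=> a b ab; apply: eq_from_tnth => i.
have := congr1 (fun P : dcube d => tnth P.2 i) ab.
rewrite /= !tnth_mktuple => /addrI/eqP; rewrite eqz_nat => /eqP.
exact: val_inj.
Qed.

Lemma dcube_of_subcube k l x : exists a : d.-tuple 'I_(2 ^ l),
  dcube_of (k + l%:Z) x = subcube (dcube_of k x) a.
Proof.
have [a xa] := subcube_cover l (mem_dcube_of k x).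
by exists a; rewrite -(dcube_of_eq xa).
Qed.

Lemma dcube_of_sub k k' x : k <= k' ->
  cube_set R (dcube_of k' x) `<=` cube_set R (dcube_of k x).
Proof.
move=> kk; have [l ->] : exists l : nat, k' = k + l%:Z by exists (absz (k' - k)); lia.
by have [a ->] := dcube_of_subcube k l x; exact: subcube_sub.
Qed.

Lemma dcube_of_coarse k k' x y : k <= k' ->
  dcube_of k' x = dcube_of k' y -> dcube_of k x = dcube_of k y.
Proof.
move=> kk e; apply: dcube_of_mem; apply: dcube_of_sub kk _ _.
by rewrite -e; exact: mem_dcube_of.
Qed.

Lemma cube_nested Q P x : Q.1 <= P.1 -> cube_set R Q x -> cube_set R P x ->
  cube_set R P `<=` cube_set R Q.
Proof.
move=> QP /dcube_of_eq qx /dcube_of_eq px; rewrite -px -qx.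
exact: dcube_of_sub.
Qed.

End DyadicCubes.

(** * Means over descendants, the conditional expectations of the grid *)

Section ChildAverages.
Variables (R : realType) (d : nat).
Implicit Types (Q P : dcube d) (F G : dcube d -> R).

(** One step of conditional expectation on functions of cubes; [iter n cavg F P] is the mean of [F]
    over the descendants [n] generations below [P], so the martingale arguments need finite sums
    only. *)
Definition cavg F Q : R :=
  (2 ^+ d)^-1 * \sum_(a : d.-tuple 'I_(2 ^ 1)) F (subcube Q a).

Lemma cavg_cst (c : R) Q : cavg (fun=> c) Q = c.
Proof.
by rewrite /cavg sumr_const card_tuple card_ord expn1 -[c *+ _]mulr_natl natrX mulKf.
Qed.

Lemma cavg_le F G Q : (forall a : d.-tuple 'I_(2 ^ 1), F (subcube Q a) <= G (subcube Q a)) ->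
  cavg F Q <= cavg G Q.
Proof.
by move=> h; rewrite ler_pM2l ?invr_gt0 ?exprn_gt0 //; apply: ler_sum.
Qed.

Lemma iter_cavg_le n F G P :
  (forall Q, Q.1 = P.1 + n%:Z -> cube_set R Q `<=` cube_set R P -> F Q <= G Q) ->
  iter n cavg F P <= iter n cavg G P.
Proof.
elim: n P => [|n IH] P h /=; first by apply: h; rewrite ?addr0.
apply: cavg_le => a; apply: IH => Q Q1 QP; apply: h.
  by rewrite Q1 /=; lia.
by move=> x /QP; exact: subcube_sub.
Qed.

Lemma iter_cavg_ext n F G P :
  (forall Q, Q.1 = P.1 + n%:Z -> cube_set R Q `<=` cube_set R P -> F Q = G Q) ->
  iter n cavg F P = iter n cavg G P.
Proof.
by move=> h; apply/eqP; rewrite eq_le !iter_cavg_le // => Q *; rewrite h.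
Qed.

Lemma iter_cavg_lin n (b c : R) F G P :
  iter n cavg (fun Q => b * F Q + c * G Q) P =
  b * iter n cavg F P + c * iter n cavg G P.
Proof.
elim: n P => [//|n IH] P /=; rewrite {1}/cavg.
under eq_bigr do rewrite IH.
rewrite big_split /= -!mulr_sumr /cavg; ring.
Qed.

Lemma cavg_lin (b c : R) F G P :
  cavg (fun Q => b * F Q + c * G Q) P = b * cavg F P + c * cavg G P.
Proof. exact: (iter_cavg_lin 1). Qed.

Lemma iter_cavg_cst n (c : R) P : iter n cavg (fun=> c) P = c.
Proof.
elim: n P => [//|n IH] P /=.
by rewrite -[RHS](cavg_cst c P); congr (_ * _); apply: eq_bigr => a _; rewrite IH.
Qed.

Lemma iter_cavg_ge0 n F P : (forall Q, 0 <= F Q) -> 0 <= iter n cavg F P.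
Proof. by move=> F0; rewrite -(iter_cavg_cst n 0 P); apply: iter_cavg_le. Qed.

(** The descendant containing [x] is one of the [(2 ^+ d) ^+ n] nonnegative terms of the mean.
    Passing from a mean to a single cube costs this factor throughout. *)
Lemma iter_cavg_ge_point n F P (x : d.-tuple R) :
  (forall Q, 0 <= F Q) -> cube_set R P x ->
  F (dcube_of (P.1 + n%:Z) x) <= (2 ^+ d) ^+ n * iter n cavg F P.
Proof.
move=> F0; elim: n P => [|n IH] P Px /=.
  by rewrite addr0 dcube_of_eq // expr0 mul1r.
have [a xa] := subcube_cover 1 Px.
have -> : P.1 + n.+1%:Z = (subcube P a).1 + n%:Z by rewrite /=; lia.
apply: le_trans (IH _ xa) _; rewrite exprSr -mulrA ler_pM2l ?exprn_gt0 //.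
rewrite /cavg mulVKf ?expf_neq0 ?pnatr_eq0 // (bigD1 a) //= lerDl.
by apply: sumr_ge0 => b _; exact: iter_cavg_ge0.
Qed.

End ChildAverages.

(** * Lebesgue measure of cubes and a dyadic maximal inequality *)

Section CubeMeasure.
Variables (R : realType) (d : nat) (mu : {measure set (d.-tuple R) -> \bar R}).
Hypotheses (d_gt0 : (0 < d)%N) (mu_leb : is_lebesgue mu).
Implicit Types (Q P : dcube d).

Definition vol Q : R := (2 ^ (- Q.1)) ^+ d.

Lemma vol_gt0 Q : 0 < vol Q.
Proof. by rewrite exprn_gt0 ?two_exprz_gt0. Qed.

Lemma vol_subcube Q l (a : d.-tuple 'I_(2 ^ l)) :
  vol Q = (2 ^+ d) ^+ l * vol (subcube Q a).
Proof.
rewrite /vol /= opprD expfzDr ?pnatr_eq0 // -(invr_expz 2 l%:Z).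
by rewrite [2 ^ l%:Z]/(_ ^+ _) exprMn exprVn exprAC mulrCA mulfV ?mulr1.
Qed.

Lemma measurable_cube Q : measurable (cube_set R Q).
Proof.
rewrite (_ : cube_set R Q = \big[setI/setT]_(i < d)
   ((@tnth d R) ^~ i @^-1` `[(tnth Q.2 i)%:~R * 2 ^ (- Q.1),
      (tnth Q.2 i + 1)%:~R * 2 ^ (- Q.1)[%classic)).
  apply: bigsetI_measurable => i _; rewrite -[X in measurable X]setTI.
  by apply: measurable_tnth.
rewrite -bigcap_seq; apply/seteqP; split=> x /= h i.
  by move=> _ /=; rewrite in_itv /=; have [-> ->] := h i.
by have := h i (mem_index_enum i); rewrite /= in_itv /= => /andP[].
Qed.

Lemma mu_cube Q : mu (cube_set R Q) = (vol Q)%:E.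
Proof.
have := @mu_leb (corner R Q) [tuple (tnth Q.2 i + 1)%:~R * (2 : R) ^ (- Q.1) | i < d].
rewrite (_ : [set x | _] = cube_set R Q); last first.
  apply/seteqP; split=> x h i; have := h i; rewrite !tnth_mktuple //.
move=> ->; last first.
  move=> i; rewrite !tnth_mktuple ler_pM2r ?two_exprz_gt0 //.
  by rewrite ler_int lerDl ler01.
congr _%:E; under eq_bigr => i _ do
  rewrite !tnth_mktuple -mulrBl -rmorphB /= addrAC subrr add0r mul1r.
by rewrite prodr_const card_ord.
Qed.

Lemma measurable_cubes (X : set (dcube d)) :
  measurable (\bigcup_(P in X) cube_set R P).
Proof.
rewrite bigcup_mkcond; apply: countable_bigcupT_measurable => [|P].
  exact: (@countableP (int * d.-tuple int)%type).
by case: ifP => _ //; exact: measurable_cube.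
Qed.

Lemma mu_cube_fin Q (B : set (d.-tuple R)) : measurable B ->
  (mu (cube_set R Q `&` B) < +oo)%E.
Proof.
move=> mB; apply: (@le_lt_trans _ _ (mu (cube_set R Q))).
  by apply: le_measure; rewrite ?inE //; try exact: measurableI _ _ (measurable_cube _) mB; exact: measurable_cube.
by rewrite mu_cube ltry.
Qed.

(** Compare volumes; [d_gt0] matters, since in dimension 0 all cubes are the same point. *)
Lemma cube_level_le Q P : cube_set R P `<=` cube_set R Q -> Q.1 <= P.1.
Proof.
move=> PQ; have : (mu (cube_set R P) <= mu (cube_set R Q))%E.
  by apply: le_measure; rewrite ?inE //; exact: measurable_cube.
rewrite !mu_cube lee_fin /vol ler_pXn2r ?nnegrE ?exprz_ge0 //.
by rewrite ler_eXz2l ?ltr1n // lerN2.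
Qed.

Lemma mu_children Q (B : set (d.-tuple R)) : measurable B ->
  mu (cube_set R Q `&` B) =
  (\sum_(a : d.-tuple 'I_(2 ^ 1)) mu (cube_set R (subcube Q a) `&` B))%E.
Proof.
move=> mB.
have -> : cube_set R Q `&` B = \bigcup_(a in [set` index_enum (d.-tuple 'I_(2 ^ 1))])
    (cube_set R (subcube Q a) `&` B).
  apply/seteqP; split=> x /=.
    by move=> [/(subcube_cover 1)[a xa] Bx]; exists a => //=; exact: mem_index_enum.
  by move=> [a _ [/subcube_sub ? ?]].
rewrite measure_fin_bigcup //.
- by rewrite [RHS]fsbig_seq ?index_enum_uniq.
- apply/trivIsetP => a b _ _ /eqP ab; rewrite -subset0 => x [[xa _] [xb _]].
  by apply: ab; apply: (@subcube_inj d Q 1); exact: cube_set_eq xa xb.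
- by move=> a _; apply: measurableI => //; exact: measurable_cube.
Qed.

Lemma mu_children_sub Q (B : set (d.-tuple R)) : measurable B ->
  (forall x, B x -> cube_set R Q x) ->
  mu B = (\sum_(a : d.-tuple 'I_(2 ^ 1)) mu (cube_set R (subcube Q a) `&` B))%E.
Proof. by move=> mB BQ; rewrite -mu_children // setIidr. Qed.

(* Doob's maximal inequality: [psi] is a nonnegative supermartingale until the
   first bad cube, where it is at least 1. *)
Lemma mu_bad_cubes (D bad : dcube d -> Prop) (psi : dcube d -> R) Q :
  (forall P a, D P -> D (@subcube d P 1 a)) ->
  (forall P, 0 <= psi P) -> (forall P, D P -> bad P -> 1 <= psi P) ->
  (forall P, D P -> ~ bad P -> cavg psi P <= psi P) -> D Q ->
  (mu (\bigcup_(P in [set P | cube_set R P `<=` cube_set R Q /\ bad P])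
    cube_set R P) <= (psi Q * vol Q)%:E)%E.
Proof.
move=> Dsub psi0 badge super DQ.
(* Only bad cubes within [n] generations are kept, so that induction on [n] works; continuity from
   below removes the restriction at the end. *)
pose B n P0 := \bigcup_(P in [set P | [/\ cube_set R P `<=` cube_set R P0,
  bad P & P.1 <= P0.1 + n%:Z]]) cube_set R P.
have mB n P0 : measurable (B n P0) by exact: measurable_cubes.
have BP0 n P0 : B n P0 `<=` cube_set R P0 by move=> x [P [PP _ _] /PP].
have main n P0 : D P0 -> (mu (B n P0) <= (psi P0 * vol P0)%:E)%E.
  elim: n P0 => [|n IH] P0 DP0.
    have [b|nb] := pselect (bad P0).
      apply: (@le_trans _ _ (mu (cube_set R P0))).
        by apply: le_measure; rewrite ?inE //; exact: measurable_cube.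
      by rewrite mu_cube lee_fin ler_peMl ?badge //; exact/ltW/vol_gt0.
    rewrite (_ : B 0%N P0 = set0) ?measure0.
      by rewrite lee_fin mulr_ge0 //; exact/ltW/vol_gt0.
    rewrite -subset0 => x [P [PP bP lP] Px]; apply: nb.
    suff <- : P = P0 by [].
    apply: (@cube_set_eq R _ _ _ x _ Px (PP _ Px)).
    by have := cube_level_le PP; move: lP; lia.
  have [b|nb] := pselect (bad P0).
    apply: (@le_trans _ _ (mu (cube_set R P0))).
      by apply: le_measure; rewrite ?inE //; exact: measurable_cube.
    by rewrite mu_cube lee_fin ler_peMl ?badge //; exact/ltW/vol_gt0.
  rewrite (@mu_children_sub P0) //; last exact: BP0.
  apply: (@le_trans _ _ (\sum_(a : d.-tuple 'I_(2 ^ 1))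
     (psi (subcube P0 a) * vol (subcube P0 a))%:E)%E); last first.
    rewrite sumEFin lee_fin.
    have e (a : d.-tuple 'I_(2 ^ 1)) : vol (subcube P0 a) = (2 ^+ d)^-1 * vol P0.
      by rewrite (vol_subcube P0 a) expr1 mulKf.
    under eq_bigr do rewrite e.
    rewrite -mulr_suml mulrCA mulrA; apply: ler_wpM2r; first exact/ltW/vol_gt0.
    exact: super.
  apply: lee_sum => a _; apply: le_trans (IH _ (Dsub _ a DP0)).
  apply: le_measure; rewrite ?inE //.
    by apply: measurableI => //; exact: measurable_cube.
  move=> x [xa [P [PP bP lP] Px]]; exists P => //; split=> //; last first.
    by move: lP; rewrite /=; lia.
  (* As [P0] is not bad, [P] is strictly smaller and hence lies in the child of [P0] containing
     [x]. *)
  have lP0 : P0.1 < P.1.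
    have := cube_level_le PP; rewrite le_eqVlt => /predU1P[e|//]; case: nb.
    by rewrite (@cube_set_eq R _ _ _ x e (PP _ Px) Px).
  by apply: cube_nested xa Px; rewrite /=; lia.
rewrite (_ : \bigcup_(P in _) _ = \bigcup_n B n Q); last first.
  apply/seteqP; split=> x [].
    move=> P [PQ bP] Px; exists (absz (P.1 - Q.1)) => //; exists P => //; split=> //.
    by have := cube_level_le PQ; lia.
  by move=> n _ [P [PQ bP _] Px]; exists P.
have nd : nondecreasing_seq (fun n => B n Q).
  move=> m n mn; apply/subsetPset => x [P [PQ bP lP] Px]; exists P => //; split=> //.
  by lia.
have mU : measurable (\bigcup_n B n Q) by apply: bigcupT_measurable.
have cv := @nondecreasing_cvg_mu _ _ _ mu (fun n => B n Q) (fun n => mB n Q) mU nd.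
rewrite -(cvg_lim _ cv) //; apply: lime_le; first by apply: cvgP cv.
by apply: nearW => n; exact: main.
Qed.

End CubeMeasure.

(** * Averages of a bounded function and the quantile of its local maximal function *)

Section Averages.
Variables (R : realType) (d : nat) (mu : {measure set (d.-tuple R) -> \bar R}).
Hypotheses (d_gt0 : (0 < d)%N) (mu_leb : is_lebesgue mu).
Variable f : d.-tuple R -> R.
Hypotheses (mf : measurable_fun setT f) (bf : exists M : R, forall x, `|f x| <= M).
Implicit Types (Q P : dcube d).

Lemma integrable_cube Q : mu.-integrable (cube_set R Q) (EFin \o f).
Proof.
apply: measurable_bounded_integrable.
- exact: measurable_cube.
- by rewrite mu_cube // ltry.
- exact: measurable_funS mf.
- have [M fM] := bf; exists M; split; first exact: num_real.
  by move=> y My x _ /=; apply: le_trans (fM x) (ltW My).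
Qed.

Lemma Rintegral_children Q : Rintegral mu (cube_set R Q) f =
  \sum_(a : d.-tuple 'I_(2 ^ 1)) Rintegral mu (cube_set R (subcube Q a)) f.
Proof.
have E : cube_set R Q =
    \big[setU/set0]_(a : d.-tuple 'I_(2 ^ 1)) cube_set R (subcube Q a).
  rewrite -bigcup_seq; apply/seteqP; split=> x /=.
    by move=> /(subcube_cover 1)[a xa]; exists a => //=; exact: mem_index_enum.
  by move=> [a _ /subcube_sub].
rewrite /Rintegral {1}E integral_bigsetU_EFin.
- rewrite -sum_fine // => a _; apply: integrable_fin_num => //.
    exact: measurable_cube.
  exact: integrable_cube.
- by move=> a; exact: measurable_cube.
- exact: index_enum_uniq.
- apply/trivIsetP => a b _ _ /eqP ab; rewrite -subset0 => x [xa xb].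
  by apply: ab; apply: (@subcube_inj d Q 1); exact: cube_set_eq xa xb.
- by apply/measurable_EFinP; exact: measurable_funS mf.
Qed.

Lemma avgE P : avg mu f P = Rintegral mu (cube_set R P) f / vol R P.
Proof. by rewrite /avg mu_cube. Qed.

Lemma Rintegral_avg P : Rintegral mu (cube_set R P) f = avg mu f P * vol R P.
Proof. by rewrite avgE divfK // lt0r_neq0 // vol_gt0. Qed.

Lemma avg_children Q : avg mu f Q = cavg (avg mu f) Q.
Proof.
rewrite avgE Rintegral_children /cavg mulr_suml mulr_sumr.
apply: eq_bigr => a _; rewrite avgE (vol_subcube R Q a) expr1 invfM.
by rewrite mulrCA.
Qed.

Lemma avg_bounded : exists2 M : R, 0 <= M & forall Q, `|avg mu f Q| <= M.
Proof.
have [M fM] := bf; exists M => [|Q].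
  by apply: le_trans (fM (corner R (0, [tuple 0 | i < d]))).
rewrite avgE normrM normfV (gtr0_norm (vol_gt0 R Q)) ler_pdivrMr ?vol_gt0 //.
have mQ := @measurable_cube R d Q.
apply: le_trans (le_normr_Rintegral _ (integrable_cube Q)) _ => //.
rewrite (_ : M * vol R Q = Rintegral mu (cube_set R Q) (fun=> M)); last first.
  by rewrite Rintegral_cst // mu_cube.
apply: le_Rintegral => //.
  exact: (integrable_norm (integrable_cube Q)).
apply: measurable_bounded_integrable => //.
  by rewrite mu_cube // ltry.
exact: bounded_cst.
Qed.

(** The part of [Q] where [MQ mu f Q] exceeds [l] (see [superlevelE]), written as a countable union
    of cubes so that measurability is immediate. *)
Definition superlevel Q (l : R) : set (d.-tuple R) :=
  \bigcup_(P in [set P | cube_set R P `<=` cube_set R Q /\ l < `|avg mu f P|])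
    cube_set R P.

Lemma measurable_superlevel Q l : measurable (superlevel Q l).
Proof. exact: measurable_cubes. Qed.

Lemma superlevel_sub Q l : superlevel Q l `<=` cube_set R Q.
Proof. by move=> x [P [PQ _] Px]; exact: PQ. Qed.

Lemma superlevelE Q l :
  cube_set R Q `&` [set x | (l%:E < MQ mu f Q x)%E] = superlevel Q l.
Proof.
apply/seteqP; split=> x /=.
  by move=> [Qx /ereal_sup_gt[_ [P [PQ Px] <-]]]; rewrite lte_fin; exists P.
move=> [P [PQ lP] Px]; split; first exact: PQ.
apply: (@lt_le_trans _ _ (`|avg mu f P|)%:E); first by rewrite lte_fin.
by apply: ereal_sup_ubound; exists P.
Qed.

Variable r : R.
Hypothesis r01 : 0 < r < 1.

Let levels Q := [set l : R | (mu (superlevel Q l) <= (r * vol R Q)%:E)%E].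

(** Otherwise [Q] itself is one of the cubes of the superlevel set, which is then all of [Q] and too
    large because [r < 1]. *)
Let levels_ge Q l : levels Q l -> `|avg mu f Q| <= l.
Proof.
move=> lQ; rewrite leNgt; apply/negP => h; move: lQ; rewrite /levels /=.
rewrite (_ : superlevel Q l = cube_set R Q); last first.
  by apply/seteqP; split; [exact: superlevel_sub|move=> x Qx; exists Q => //; split].
by rewrite mu_cube // lee_fin ler_pMl ?vol_gt0 // leNgt; case/andP: r01 => _ ->.
Qed.

Definition lam Q : R := fine (Pquant mu r (cube_set R Q) (MQ mu f Q)).

Let PquantE Q : Pquant mu r (cube_set R Q) (MQ mu f Q) =
  ereal_inf [set l%:E | l in levels Q].
Proof.
rewrite /Pquant; congr (ereal_inf (_ @` _)).
by apply/seteqP; split=> l /=; rewrite superlevelE /levels /= mu_cube // -EFinM.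
Qed.

(** The quantile is finite: admissible levels are nonnegative by [levels_ge], and a uniform bound of
    the averages is admissible. *)
Lemma PquantE_lam Q : Pquant mu r (cube_set R Q) (MQ mu f Q) = (lam Q)%:E.
Proof.
rewrite /lam fineK //; have [M M0 bM] := avg_bounded.
rewrite fin_numE; apply/andP; split.
  apply/negP => /eqP h.
  have : (0%:E <= Pquant mu r (cube_set R Q) (MQ mu f Q))%E.
    rewrite PquantE; apply: le_ereal_inf_tmp => _ [l /levels_ge lQ <-].
    by rewrite lee_fin (le_trans _ lQ).
  by rewrite h.
apply/negP => /eqP h.
have : (Pquant mu r (cube_set R Q) (MQ mu f Q) <= M%:E)%E.
  rewrite PquantE; apply: ereal_inf_lbound; exists M => //.
  rewrite /levels /= (_ : superlevel Q M = set0) ?measure0 ?lee_fin.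
    by rewrite mulr_ge0 //; [case/andP: r01 => /ltW|exact/ltW/vol_gt0].
  by rewrite -subset0 => x [P [_]]; rewrite ltNge bM.
by rewrite h.
Qed.

Lemma avg_le_lam Q : `|avg mu f Q| <= lam Q.
Proof.
rewrite -lee_fin -PquantE_lam PquantE; apply: le_ereal_inf_tmp.
by move=> _ [l /levels_ge lQ <-]; rewrite lee_fin.
Qed.

Lemma lam_ge0 Q : 0 <= lam Q.
Proof. exact: le_trans (avg_le_lam Q). Qed.

(** The infimum defining the quantile is attained: the superlevel sets at [lam Q + 1/(n+1)] increase
    to the one at [lam Q], and continuity from below applies. *)
Lemma mu_superlevel_lam Q : (mu (superlevel Q (lam Q)) <= (r * vol R Q)%:E)%E.
Proof.
pose F n := superlevel Q (lam Q + n.+1%:R^-1).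
have FE : superlevel Q (lam Q) = \bigcup_n F n.
  apply/seteqP; split=> x.
    move=> [P [PQ lP] Px].
    have lP' : 0 < `|avg mu f P| - lam Q by rewrite subr_gt0.
    have [n _ hn] := near_infty_natSinv_lt (PosNum lP').
    exists n => //; exists P => //; split=> //.
    by have := hn n (leqnn n); rewrite /= ltrBrDl.
  move=> [n _ [P [PQ lP] Px]]; exists P => //; split=> //.
  by apply: le_lt_trans lP; rewrite lerDl.
have mF n : measurable (F n) by exact: measurable_superlevel.
have nd : nondecreasing_seq F.
  move=> m n mn; apply/subsetPset => x [P [PQ lP] Px]; exists P => //; split=> //.
  apply: le_lt_trans lP; rewrite lerD2l lef_pV2 ?posrE ?ltr0n //.
  by rewrite ler_nat.
have mU : measurable (\bigcup_n F n) by apply: bigcupT_measurable.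
have cv := @nondecreasing_cvg_mu _ _ _ mu F mF mU nd.
rewrite FE -(cvg_lim _ cv) //; apply: lime_le; first by apply: cvgP cv.
apply: nearW => n.
have : (ereal_inf [set l%:E | l in levels Q] < (lam Q + n.+1%:R^-1)%:E)%E.
  by rewrite -PquantE PquantE_lam lte_fin ltrDl.
move=> /ereal_inf_lt[_ [l lQ <-]]; rewrite lte_fin => ll.
apply: le_trans lQ; apply: le_measure; rewrite ?inE //.
  exact: measurable_superlevel.
by move=> x [P [PQ lP] Px]; exists P => //; split=> //; exact: lt_trans lP.
Qed.

(** A descendant with a larger average would lie entirely in the superlevel set, whose proportion
    [r] in [Q] is smaller than that of the descendant. *)
Lemma avg_descendant_le_lam Q l x : r * (2 ^+ d) ^+ l < 1 -> cube_set R Q x ->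
  `|avg mu f (dcube_of (Q.1 + l%:Z) x)| <= lam Q.
Proof.
move=> rl Qx; rewrite leNgt; apply/negP => h.
have sub : cube_set R (dcube_of (Q.1 + l%:Z) x) `<=` cube_set R Q.
  by rewrite -{2}(dcube_of_eq Qx); apply: dcube_of_sub; lia.
have : (mu (cube_set R (dcube_of (Q.1 + l%:Z) x)) <= (r * vol R Q)%:E)%E.
  apply: le_trans (mu_superlevel_lam Q); apply: le_measure; rewrite ?inE.
  - exact: measurable_cube.
  - exact: measurable_superlevel.
  - by move=> y ly; exists (dcube_of (Q.1 + l%:Z) x).
have [a ->] := dcube_of_subcube Q.1 l x; rewrite dcube_of_eq //.
rewrite mu_cube // lee_fin (vol_subcube R Q a) mulrA ler_pMl ?vol_gt0 //.
by rewrite leNgt rl.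
Qed.

End Averages.

(** * Stopping cubes of a model operator and their measure *)

Section StoppingCubes.
Variables (R : realType) (d : nat) (mu : {measure set (d.-tuple R) -> \bar R}).
Hypotheses (d_gt0 : (0 < d)%N) (mu_leb : is_lebesgue mu).
Variable f : d.-tuple R -> R.
Hypotheses (mf : measurable_fun setT f) (bf : exists M : R, forall x, `|f x| <= M).
Implicit Types (Q P : dcube d) (x y : d.-tuple R).

(** [gen k] models the generation [k] term of the operator, a martingale difference living on the
    cubes of generation [k + s]. Martingale transforms have [s = t = 0], Haar shifts of complexity
    [(t, s)] use these same parameters, and the zero function serves for the maximal operator. *)
Variables (s t : nat) (K : R) (gen : int -> d.-tuple R -> R).
Hypothesis K_ge1 : 1 <= K.

Let v P := avg mu f P ^+ 2.

Hypothesis gen_cst : forall k x y,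
  dcube_of (k + s.+1%:Z) x = dcube_of (k + s.+1%:Z) y -> gen k x = gen k y.
Hypothesis gen_mean0 : forall P,
  cavg (fun c => gen (P.1 - s%:Z) (corner R c)) P = 0.
Hypothesis gen_osc : forall k x, gen k x ^+ 2 <=
  K * (iter t.+1 (@cavg R d) v (dcube_of k x) - iter t (@cavg R d) v (dcube_of k x)).

(** This constant and [thresh] are chosen to make each of the two terms of [psi Q Q] at most 1/8. *)
Definition rquant : R := ((2 ^+ d) ^+ t.+1 * 8)^-1.
Definition thresh : R := (2 ^+ d) ^+ s * 8 * K.

Let pow2_ge1 n : 1 <= ((2 : R) ^+ d) ^+ n.
Proof. by rewrite !exprn_ege1 // ler1n. Qed.

Lemma rquant01 : 0 < rquant < 1.
Proof.
have := pow2_ge1 t.+1; set z := _ ^+ t.+1; rewrite /rquant -/z => z1.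
have z8 : 0 < z * 8 by lra.
by rewrite invr_gt0 invf_lt1 z8 //; lra.
Qed.

Let thresh_ge1 : 1 <= thresh.
Proof.
have K1 := K_ge1.
have := pow2_ge1 s; set z := _ ^+ s; rewrite /thresh -/z => z1.
have : 0 <= (z - 1) * K by apply: mulr_ge0; lra.
nra.
Qed.

Local Notation L Q := (lam mu f rquant Q).

Let L_ge0 Q : 0 <= L Q.
Proof. exact: lam_ge0 rquant01 _. Qed.

Definition psum Q (m : nat) x : R := \sum_(i < m) gen (Q.1 + i%:Z) x.

(** Depth [t.+1] is how far down [gen_osc] looks when it bounds [gen P.1] on [P]. *)
Definition avg_ctrl Q P := forall j x, (j <= t.+1)%N -> cube_set R P x ->
  `|avg mu f (dcube_of (P.1 + j%:Z) x)| <= L Q.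

(** One point of [P] suffices in the second clause, since for [s > 0] the partial sum may vary
    inside [P]. The clause is off when [L Q = 0], where control of the averages alone makes the
    terms vanish. *)
Definition bad Q P := ~ avg_ctrl Q P \/
  0 < L Q /\ exists2 x, cube_set R P x &
    thresh * L Q < `|psum Q (absz (P.1 - Q.1)) x|.

Lemma avg_ctrl_self Q : avg_ctrl Q Q.
Proof.
have K1 := K_ge1; have T1 := thresh_ge1.
move=> j x jt Qx; apply: avg_descendant_le_lam => //; first exact: rquant01.
rewrite /rquant mulrC; have zt := pow2_ge1 t.+1; have zj := pow2_ge1 j.
rewrite ltr_pdivrMr ?mul1r; last by lra.
apply: (@le_lt_trans _ _ ((2 ^+ d) ^+ t.+1)); last by lra.
by apply: ler_weXn2l => //; rewrite exprn_ege1 // ler1n.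
Qed.

Let avg_ctrl_sub Q P j c : avg_ctrl Q P -> (j <= t.+1)%N -> c.1 = P.1 + j%:Z ->
  cube_set R c `<=` cube_set R P -> v c <= L Q ^+ 2.
Proof.
move=> ctrl jt c1 cP; have := ctrl j (corner R c) jt (cP _ (mem_corner R c)).
rewrite -c1 (dcube_of_eq (mem_corner R c)) => h.
by rewrite /v -[leLHS]ger0_norm ?sqr_ge0 // normrX ler_pXn2r ?nnegrE.
Qed.

(** In [gen_osc] drop the subtracted mean and bound the other one by [L Q ^+ 2]; then [K <= K ^+ 2]
    allows taking square roots. *)
Lemma gen_le Q P x : avg_ctrl Q P -> cube_set R P x -> `|gen P.1 x| <= K * L Q.
Proof.
have K1 := K_ge1; have T1 := thresh_ge1.
move=> ctrl Px; rewrite -(@ler_pXn2r _ 2) ?nnegrE ?mulr_ge0 ?L_ge0 //; last by lra.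
rewrite -normrX ger0_norm ?sqr_ge0 //; apply: le_trans (gen_osc _ _) _.
rewrite dcube_of_eq // exprMn.
have h1 : iter t.+1 (@cavg R d) v P <= L Q ^+ 2.
  rewrite -[leRHS](iter_cavg_cst t.+1 _ P); apply: iter_cavg_le => c c1 cP.
  exact: avg_ctrl_sub c1 cP.
have h2 : 0 <= iter t (@cavg R d) v P by apply: iter_cavg_ge0 => c; exact: sqr_ge0.
have L2 : 0 <= L Q ^+ 2 := sqr_ge0 _.
apply: (@le_trans _ _ (K * L Q ^+ 2)); first by rewrite ler_wpM2l //; lra.
by rewrite ler_wpM2r // expr2 ler_peMl //; lra.
Qed.

Lemma psum_cst Q m x y (k : int) : Q.1 + m%:Z + s%:Z <= k ->
  dcube_of k x = dcube_of k y -> psum Q m x = psum Q m y.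
Proof.
move=> mk xy; apply: eq_bigr => i _; apply: gen_cst.
by apply: dcube_of_coarse xy; have := ltn_ord i; lia.
Qed.

Let W Q := superlevel mu f Q (L Q).

Let mW Q : measurable (W Q).
Proof. exact: measurable_superlevel. Qed.

Let density Q P : R := fine (mu (cube_set R P `&` W Q)) / vol R P.

(* The first term is a submartingale whose increments are paid for by the second,
   by [gen_mean0] and [gen_osc]; the means reach [s] and [t] generations down
   because [gen P.1] is only constant on, resp. only controlled by, such cubes. *)
Let energy Q P : R :=
  1 * iter s (@cavg R d) (fun c => psum Q (absz (P.1 - Q.1)) (corner R c) ^+ 2) P +
  K * iter t (@cavg R d) (fun c => Num.max 0 (L Q ^+ 2 - v c)) P.

(* The second coefficient is 0 when [L Q = 0], by the convention [x / 0 = 0]. *)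
Let psi Q P : R := (2 ^+ d) ^+ t.+1 * density Q P +
  (2 ^+ d) ^+ s / (thresh * L Q) ^+ 2 * energy Q P.

Let density_ge0 Q P : 0 <= density Q P.
Proof. by rewrite divr_ge0 ?fine_ge0 //; exact/ltW/vol_gt0. Qed.

Let energy_ge0 Q P : 0 <= energy Q P.
Proof.
have K1 := K_ge1; have T1 := thresh_ge1.
rewrite addr_ge0 ?mulr_ge0 //; try lra; apply: iter_cavg_ge0 => c.
  exact: sqr_ge0.
by rewrite le_max lexx.
Qed.

Let coef_ge0 Q : 0 <= (2 ^+ d) ^+ s / (thresh * L Q) ^+ 2.
Proof. by apply: divr_ge0; [rewrite !exprn_ge0|exact: sqr_ge0]. Qed.

Let psi_ge0 Q P : 0 <= psi Q P.
Proof. by rewrite addr_ge0 // mulr_ge0 // !exprn_ge0. Qed.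

Let mu_W_fin Q P : mu (cube_set R P `&` W Q) \is a fin_num.
Proof. by rewrite ge0_fin_numE // mu_cube_fin. Qed.

(** If control fails, a descendant at most [t.+1] generations down lies in [W Q], so the density is
    at least [(2 ^+ d) ^- t.+1]. If the partial sum is large at a point, it is so on a whole
    descendant [s] generations down, which carries a fraction [(2 ^+ d) ^- s] of the mean square. *)
Let psi_bad Q P : cube_set R P `<=` cube_set R Q -> bad Q P -> 1 <= psi Q P.
Proof.
have K1 := K_ge1; have T1 := thresh_ge1.
move=> PQ [nctrl|[L0 [x Px xu]]].
  apply: (@le_trans _ _ ((2 ^+ d) ^+ t.+1 * density Q P)); last first.
    by rewrite lerDl mulr_ge0.
  have [j [x [jt Px xL]]] : exists j x, [/\ (j <= t.+1)%N, cube_set R P x &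
      L Q < `|avg mu f (dcube_of (P.1 + j%:Z) x)|].
    apply: contrapT => h; apply: nctrl => j x jt Px; rewrite leNgt; apply/negP => xL.
    by apply: h; exists j, x.
  have cP : cube_set R (dcube_of (P.1 + j%:Z) x) `<=` cube_set R P.
    by rewrite -{2}(dcube_of_eq Px); apply: dcube_of_sub; lia.
  have vP : vol R P = (2 ^+ d) ^+ j * vol R (dcube_of (P.1 + j%:Z) x).
    have [a ->] := dcube_of_subcube P.1 j x; rewrite dcube_of_eq //.
    exact: vol_subcube.
  rewrite /density mulrA ler_pdivlMr ?vol_gt0 // mul1r vP.
  apply: (@le_trans _ _ ((2 ^+ d) ^+ t.+1 * vol R (dcube_of (P.1 + j%:Z) x))).
    rewrite ler_wpM2r //; first exact/ltW/vol_gt0.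
    by apply: ler_weXn2l => //; rewrite exprn_ege1 // ler1n.
  rewrite ler_wpM2l ?exprn_ge0 // -lee_fin fineK // -(mu_cube mu_leb).
  apply: le_measure; rewrite ?inE.
  - exact: measurable_cube.
  - by apply: measurableI => //; exact: measurable_cube.
  - move=> y cy; split; first exact: cP.
    by exists (dcube_of (P.1 + j%:Z) x) => //; split=> // z /cP /PQ.
apply: (@le_trans _ _ ((2 ^+ d) ^+ s / (thresh * L Q) ^+ 2 * energy Q P)); last first.
  by rewrite lerDr mulr_ge0 // exprn_ge0.
have T0 : 0 < thresh * L Q by rewrite mulr_gt0 //; lra.
rewrite mulrAC ler_pdivlMr ?exprn_gt0 // mul1r.
pose F c := psum Q (absz (P.1 - Q.1)) (corner R c) ^+ 2.
apply: (@le_trans _ _ ((2 ^+ d) ^+ s * iter s (@cavg R d) F P)); last first.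
  rewrite ler_wpM2l ?exprn_ge0 // /energy mul1r lerDl mulr_ge0 //; first by lra.
  by apply: iter_cavg_ge0 => c; rewrite le_max lexx.
apply: le_trans (iter_cavg_ge_point s _ Px); last by move=> c; exact: sqr_ge0.
rewrite /F -(psum_cst (k := P.1 + s%:Z) (x := x)).
- by rewrite -[leRHS]ger0_norm ?sqr_ge0 // normrX ler_pXn2r ?nnegrE //; exact: ltW.
- by have := cube_level_le d_gt0 mu_leb PQ; lia.
- by rewrite -[LHS](dcube_of_eq (mem_corner R _)).
Qed.

Let density_mean Q P : cavg (density Q) P = density Q P.
Proof.
rewrite /density mu_children // -sum_fine; last by move=> a _; exact: mu_W_fin.
rewrite /cavg mulr_suml mulr_sumr; apply: eq_bigr => a _.
by rewrite (vol_subcube R P a) expr1 invfM mulrCA.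
Qed.

Let energy_super Q P : cube_set R P `<=` cube_set R Q -> avg_ctrl Q P ->
  cavg (energy Q) P <= energy Q P.
Proof.
move=> PQ ctrl; have lPQ := cube_level_le d_gt0 mu_leb PQ.
set m := absz (P.1 - Q.1); have mE : P.1 = Q.1 + m%:Z by rewrite /m; lia.
pose F n c := psum Q n (corner R c) ^+ 2.
pose V n := iter n (@cavg R d) v P.
(* Control of the averages makes the truncation at 0 inactive down to depth [t.+1]. *)
have maxE n : (n <= t.+1)%N ->
    iter n (@cavg R d) (fun c => Num.max 0 (L Q ^+ 2 - v c)) P = L Q ^+ 2 - V n.
  move=> nt; rewrite -{2}(iter_cavg_cst n (L Q ^+ 2) P) /V.
  rewrite -[X in X - _]mul1r -mulN1r -iter_cavg_lin.
  apply: iter_cavg_ext => c c1 cP; rewrite mul1r mulN1r.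
  by apply/max_idPr; rewrite subr_ge0; exact: avg_ctrl_sub c1 cP.
rewrite (_ : cavg (energy Q) P = 1 * iter s.+1 (@cavg R d) (F m.+1) P +
  K * iter t.+1 (@cavg R d) (fun c => Num.max 0 (L Q ^+ 2 - v c)) P); last first.
  transitivity (cavg (fun c => 1 * iter s (@cavg R d) (F m.+1) c +
    K * iter t (@cavg R d) (fun c => Num.max 0 (L Q ^+ 2 - v c)) c) P).
    congr (_ * _); apply: eq_bigr => a _; rewrite /energy.
    by rewrite (_ : absz _ = m.+1) //=; lia.
  exact: cavg_lin.
rewrite /energy -/m -/(F m) !maxE //.
(* The growth of the mean square must not exceed [K * (V t.+1 - V t)], which is exactly what the
   second term of the energy loses. *)
suff : iter s.+1 (@cavg R d) (F m.+1) P <=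
    iter s (@cavg R d) (F m) P + K * (V t.+1 - V t) by nra.
rewrite iterSr -[X in _ + X](iter_cavg_cst s _ P) -[X in X + _]mul1r.
rewrite -[X in _ + X]mul1r -iter_cavg_lin; apply: iter_cavg_le => c c1 cP.
rewrite !mul1r.
have in_c (a : d.-tuple 'I_(2 ^ 1)) : cube_set R c (corner R (subcube c a)).
  exact: subcube_sub (mem_corner R _).
(* Orthogonality: [psum Q m] is constant on [c] and [gen P.1] has mean zero over the children of
   [c], so the cross term vanishes. *)
have -> : cavg (F m.+1) c = F m c + cavg (fun b => gen P.1 (corner R b) ^+ 2) c.
  have step (a : d.-tuple 'I_(2 ^ 1)) : F m.+1 (subcube c a) =
      F m c + psum Q m (corner R c) *+ 2 * gen P.1 (corner R (subcube c a)) +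
        gen P.1 (corner R (subcube c a)) ^+ 2.
    rewrite /F {1}/psum big_ord_recr /= -/(psum Q m _) -mE.
    rewrite (@psum_cst Q m _ (corner R c) c.1).
    - by rewrite sqrrD; ring.
    - by lia.
    - by rewrite !dcube_of_eq //; exact: mem_corner.
  rewrite {1}/cavg; under eq_bigr do rewrite step.
  rewrite big_split /= mulrDr; congr (_ + _).
  rewrite big_split /= mulrDr -[X in _ + _ * X]mulr_sumr [X in _ + X]mulrCA.
  have := gen_mean0 c; rewrite (_ : c.1 - s%:Z = P.1); last by lia.
  rewrite /cavg => ->; rewrite mulr0 addr0.
  exact: (cavg_cst (F m c) c).
rewrite lerD2l -[leRHS](cavg_cst _ c); apply: cavg_le => a.
by apply: le_trans (gen_osc _ _) _; rewrite dcube_of_eq //; exact/cP/in_c.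
Qed.

Let psi_super Q P : cube_set R P `<=` cube_set R Q -> ~ bad Q P ->
  cavg (psi Q) P <= psi Q P.
Proof.
move=> PQ nb; have ctrl : avg_ctrl Q P.
  by apply: contrapT => h; apply: nb; left.
have -> : cavg (psi Q) P = (2 ^+ d) ^+ t.+1 * cavg (density Q) P +
    (2 ^+ d) ^+ s / (thresh * L Q) ^+ 2 * cavg (energy Q) P.
  exact: cavg_lin.
by rewrite density_mean lerD2l ler_wpM2l // energy_super.
Qed.

(** The density at [Q] is at most [rquant], and the partial sum is empty there, so the energy is at
    most [K * L Q ^+ 2]. *)
Let psi_self Q : psi Q Q <= 4^-1.
Proof.
have K1 := K_ge1; have T1 := thresh_ge1.
have z1 := pow2_ge1 t.+1; have y1 := pow2_ge1 s.
have h1 : (2 ^+ d) ^+ t.+1 * density Q Q <= 8^-1.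
  rewrite /density setIidr; last exact: superlevel_sub.
  rewrite mulrA ler_pdivrMr ?vol_gt0 //.
  have : fine (mu (W Q)) <= rquant * vol R Q.
    rewrite -lee_fin fineK; first exact: mu_superlevel_lam rquant01 _.
    by have := mu_W_fin Q Q; rewrite setIidr //; exact: superlevel_sub.
  move=> h; apply: le_trans (ler_wpM2l _ h) _; first by lra.
  by rewrite /rquant invfM mulrA mulrA mulfV ?mul1r //; lra.
have h2 : (2 ^+ d) ^+ s / (thresh * L Q) ^+ 2 * energy Q Q <= 8^-1.
  have e : energy Q Q <= K * L Q ^+ 2.
    rewrite /energy subrr /= mul1r.
    rewrite (@iter_cavg_ext _ _ _ _ (fun=> 0)); last first.
      by move=> c _ _; rewrite /psum big_ord0 expr0n.
    rewrite iter_cavg_cst add0r ler_wpM2l //; first by lra.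
    rewrite -[leRHS](iter_cavg_cst t _ Q); apply: iter_cavg_le => c _ _.
    by rewrite ge_max sqr_ge0 gerBl sqr_ge0.
  apply: le_trans (ler_wpM2l (coef_ge0 Q) e) _.
  have [->|L0] := eqVneq (L Q) 0; first by rewrite expr0n /= !mulr0 invr_ge0.
  have T0 : thresh != 0 by apply: lt0r_neq0; lra.
  have -> : (2 ^+ d) ^+ s / (thresh * L Q) ^+ 2 * (K * L Q ^+ 2) =
      (2 ^+ d) ^+ s * K / thresh ^+ 2.
    by move: (thresh) (L Q) ((2 ^+ d) ^+ s) T0 L0 => th l y T0 L0; field; rewrite T0 L0.
  rewrite ler_pdivrMr; last by rewrite exprn_gt0 //; lra.
  apply: (@le_trans _ _ (8^-1 * thresh)); first by rewrite /thresh; lra.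
  by rewrite ler_wpM2l // expr2 ler_peMl //; lra.
by rewrite /psi; lra.
Qed.

Lemma mu_bad Q :
  (mu (\bigcup_(P in [set P | cube_set R P `<=` cube_set R Q /\ bad Q P])
    cube_set R P) <= (4^-1 * vol R Q)%:E)%E.
Proof.
apply: le_trans (@mu_bad_cubes _ _ mu d_gt0 mu_leb
   (fun P => cube_set R P `<=` cube_set R Q) (bad Q) (psi Q) Q _ _ _ _ _) _ => //.
- by move=> P a PQ x /subcube_sub /PQ.
- by move=> P PQ; exact: psi_bad.
- by move=> P PQ; exact: psi_super.
- by rewrite lee_fin ler_wpM2r //; exact/ltW/vol_gt0.
Qed.

(** All terms but the last form the partial sum tested at the last cube before the stopping one,
    hence are below the threshold; the last term is bounded by [gen_le] on that same cube. *)
Lemma psum_le Q n x : cube_set R Q x ->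
  (forall i, (0 < i < n)%N -> ~ bad Q (dcube_of (Q.1 + i%:Z) x)) ->
  `|psum Q n x| <= (thresh + K) * L Q.
Proof.
have K1 := K_ge1; have T1 := thresh_ge1.
move=> Qx nb.
have g i : (i < n)%N -> `|gen (Q.1 + i%:Z) x| <= K * L Q.
  move=> ni; apply: (@gen_le Q (dcube_of (Q.1 + i%:Z) x)); last exact: mem_dcube_of.
  case: i ni => [|i] ni; first by rewrite addr0 dcube_of_eq //; exact: avg_ctrl_self.
  by apply: contrapT => h; apply: (nb i.+1) => //; left.
case: n nb g => [|n] nb g.
  by rewrite /psum big_ord0 normr0 mulr_ge0 //; lra.
rewrite /psum big_ord_recr /= -/(psum Q n x) mulrDl.
apply: le_trans (ler_normD _ _) _; apply: lerD; last exact: g.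
have := L_ge0 Q; rewrite le_eqVlt => /predU1P[L0|L0].
  rewrite -L0 mulr0; apply: le_trans (ler_norm_sum _ _ _) _.
  apply: (@le_trans _ _ (\sum_(i < n) 0)); last by rewrite big1.
  by apply: ler_sum => i _; have := g i (ltnW (ltn_ord i)); rewrite -L0 mulr0.
case: n nb g => [|n] nb g.
  by rewrite /psum big_ord0 normr0 mulr_ge0 ?ltW //; lra.
rewrite leNgt; apply/negP => h; apply: (nb n.+1); first by rewrite ltnSn.
right; split=> //; exists x; first exact: mem_dcube_of.
by rewrite (_ : absz _ = n.+1) //=; lia.
Qed.

Lemma avg_le Q n x : cube_set R Q x ->
  (forall i, (0 < i < n.+1)%N -> ~ bad Q (dcube_of (Q.1 + i%:Z) x)) ->
  `|avg mu f (dcube_of (Q.1 + n%:Z) x)| <= L Q.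
Proof.
move=> Qx; case: n => [|n] nb; first by apply: avg_ctrl_self.
apply: contrapT => h; apply: (nb n.+1); first by rewrite ltnSn.
left=> ctrl; apply: h; rewrite -[X in _ + X]addr0 addrA.
exact: (ctrl 0%N x _ (mem_dcube_of _ _)).
Qed.

End StoppingCubes.

(** * Selection of the sparse family *)

Section Selection.
Variables (R : realType) (d : nat) (mu : {measure set (d.-tuple R) -> \bar R}).
Hypotheses (d_gt0 : (0 < d)%N) (mu_leb : is_lebesgue mu).
Implicit Types (Q P : dcube d) (x y : d.-tuple R).

(* The cubes having the origin in their closure are always selected: every point
   lies in arbitrarily large ones, so there is no largest scale to start from. *)
Definition touches0 Q := forall i, tnth Q.2 i = 0 \/ tnth Q.2 i = -1.

Lemma touches0_dcube_of x : exists N : nat, forall n : nat, (N <= n)%N ->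
  touches0 (dcube_of (- n%:Z) x).
Proof.
exists (Num.bound (\sum_i `|tnth x i|)) => n Nn i; rewrite tnth_mktuple.
have xn : `|tnth x i| < 2 ^+ n.
  apply: (@le_lt_trans _ _ (\sum_i `|tnth x i|)).
    by rewrite (bigD1 i) //= lerDl sumr_ge0.
  apply: lt_le_trans (archi_boundP _) _; first exact: sumr_ge0.
  by rewrite -natrX ler_nat (leq_trans Nn) // ltnW // ltn_expl.
rewrite -invr_expz [2 ^ n%:Z]/(_ ^+ _).
have n0 : 0 < (2 : R) ^+ n by rewrite exprn_gt0.
move: xn; rewrite ltr_norml => /andP[x1 x2].
have [x0|x0] := leP 0 (tnth x i); [left|right]; apply: floor_def.
  by rewrite mulrC ler_pdivlMr // ltr_pdivrMr // mul0r x0 add0r mul1r.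
by rewrite mulrC ler_pdivlMr // ltr_pdivrMr // mulN1r addNr mul0r x0 (ltW x1).
Qed.

(** Indices 0 and -1 are fixed by halving and rounding down. Hence a given cube contains at most one
    cube of each generation touching the origin. *)
Lemma touches0_dcube_of_le k l x : k <= l -> touches0 (dcube_of l x) ->
  (dcube_of k x).2 = (dcube_of l x).2.
Proof.
move=> kl top; apply: eq_from_tnth => i; have := top i; rewrite !tnth_mktuple.
have [n ->] : exists n : nat, l = k + n%:Z by exists (absz (l - k)); lia.
rewrite expfzDr ?pnatr_eq0 // [2 ^ n%:Z]/(_ ^+ _) mulrAC.
set y := 2 ^ k * _; have n1 : 1 <= (2 : R) ^+ n by rewrite exprn_ege1 // ler1n.
have := floor_itv (y * 2 ^+ n); move/[swap].
by case=> -> /andP[/= h1 h2]; apply: floor_def; apply/andP; split; nra.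
Qed.

(** [ctrl Q P] means that control is lost at [P]; it is later taken to be [bad]. *)
Variables (eps : R) (ctrl : dcube d -> dcube d -> Prop).
Hypothesis ctrl_small : forall Q,
  (mu (\bigcup_(P in [set P | cube_set R P `<=` cube_set R Q /\ ctrl Q P])
    cube_set R P) <= (4^-1 * vol R Q)%:E)%E.

Definition stop Q P := ctrl Q P \/ touches0 P.

Definition stopped Q :=
  [set P | [/\ cube_set R P `<=` cube_set R Q, Q.1 < P.1 & stop Q P]].

(** All cubes touching the origin are roots at once, so chains from different roots overlap;
    [separated_selected] shows that they are compatible. *)
Inductive selected : dcube d -> Prop :=
| selected_top Q : touches0 Q -> selected Q
| selected_next Q P : selected Q -> stopped Q P ->
    (forall P', cube_set R P `<=` cube_set R P' -> P'.1 < P.1 -> ~ stopped Q P') ->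
    selected P.

Definition sparse_part Q :=
  cube_set R Q `\` \bigcup_(P in stopped Q) cube_set R P.

Lemma mu_sparse_part Q : ((4^-1)%:E * mu (cube_set R Q) <= mu (sparse_part Q))%E.
Proof.
set B := \bigcup_(P in stopped Q) cube_set R P.
have mB : measurable B by exact: measurable_cubes.
(* All stopped cubes touching the origin lie in [P0], whose volume is at most half that of [Q]. With
   a quarter lost to [ctrl], a quarter remains. *)
pose P0 : dcube d := (Q.1 + 1, Q.2).
pose B' := \bigcup_(P in [set P | cube_set R P `<=` cube_set R Q /\ ctrl Q P])
    cube_set R P.
have mB' : measurable B' by exact: measurable_cubes.
have BB : B `<=` B' `|` cube_set R P0.
  move=> x [P [PQ lP [bP|tP]] Px]; first by left; exists P.
  right; apply/cube_setE; rewrite /P0 /= [LHS]surjective_pairing /=; congr pair.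
  have Qx := PQ _ Px; rewrite -(dcube_of_eq Px) in tP.
  transitivity (dcube_of P.1 x).2.
    by apply: touches0_dcube_of_le tP; lia.
  rewrite -[in RHS](dcube_of_eq Qx); symmetry.
  by apply: touches0_dcube_of_le tP; lia.
have vP0 : vol R P0 <= 2^-1 * vol R Q.
  rewrite /vol /= opprD expfzDr ?pnatr_eq0 // exprMn mulrC ler_wpM2r //.
    by rewrite exprn_ge0 // exprz_ge0.
  rewrite -[d]prednK // exprS ger_pMr ?invr_gt0 //.
  by rewrite exprn_ile1 // ?invr_ge0 // invf_le1 // ler1n.
have Bfin : mu B \is a fin_num.
  rewrite ge0_fin_numE // -(setIidr (_ : B `<=` cube_set R Q)).
    exact: mu_cube_fin.
  by move=> x [P [PQ _ _] Px]; exact: PQ.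
have : (mu B <= (3 / 4 * vol R Q)%:E)%E.
  apply: (@le_trans _ _ (mu B' + mu (cube_set R P0))%E).
    apply: le_trans (measureU2 _ _ _) => //; last exact: measurable_cube.
    apply: le_measure; rewrite ?inE //.
    by apply: measurableU => //; exact: measurable_cube.
  apply: le_trans (leeD (ctrl_small Q) (lexx _)) _.
  by rewrite mu_cube // -EFinD lee_fin; lra.
have BQ : B `<=` cube_set R Q by move=> x [P [PQ _ _] Px]; exact: PQ.
have Qfin : (mu (cube_set R Q) < +oo)%E by rewrite mu_cube // ltry.
have e : mu (cube_set R Q `\` B) = ((vol R Q)%:E - mu B)%E.
  rewrite -(mu_cube mu_leb) -[in X in (_ - X)%E](setIidr BQ).
  by apply: measureD => //; exact: measurable_cube.
rewrite /sparse_part -/B e mu_cube // -(fineK Bfin) -EFinM -EFinB !lee_fin; lra.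
Qed.

Let separated Q' Q := Q.1 < Q'.1 -> cube_set R Q' `<=` cube_set R Q ->
  exists2 P, stopped Q P & cube_set R Q' `<=` cube_set R P.

(** Induction on the smaller cube [P], comparing its parent [Q] with [Q']. If [Q] is larger than
    [Q'], the stopped cube of [Q] around [Q'] contradicts the maximality of [P]; if smaller, the
    induction hypothesis applies. *)
Let separated_below Q' : (forall Q, selected Q -> separated Q' Q) ->
  forall Q, selected Q -> separated Q Q'.
Proof.
move=> sep Q; elim=> {Q} [Q top|Q P SQ IH stP maxP] lt sub.
  by exists Q => //; split=> //; right.
have [PQ QP _] := stP.
have x := mem_corner R P; have Qx := PQ _ x; have Q'x := sub _ x.
have [ll|ll|ll] := ltgtP Q.1 Q'.1.
- have [|P' stP' P'Q'] := sep _ SQ ll; first exact: cube_nested (ltW ll) Qx Q'x.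
  case: (maxP P') => //; first by move=> y /sub /P'Q'.
  by have := cube_level_le d_gt0 mu_leb P'Q'; move: lt; lia.
- have [|P' stP' QP'] := IH ll; first exact: cube_nested (ltW ll) Q'x Qx.
  by exists P' => // y /PQ /QP'.
- by exists P => //; rewrite -(cube_set_eq ll Qx Q'x).
Qed.

(** The same comparison with the parent [Q''] of [Q']; when [Q] lies strictly inside [Q''], the
    roles are exchanged through [separated_below]. *)
Let separated_selected Q' : selected Q' -> forall Q, selected Q -> separated Q' Q.
Proof.
elim=> {Q'} [Q' top|Q'' Q' S'' IH stQ' maxQ'] Q SQ lt sub.
  by exists Q' => //; split=> //; right.
have [Q'Q'' lQ' _] := stQ'.
have x := mem_corner R Q'; have Qx := sub _ x; have Q''x := Q'Q'' _ x.
have [ll|ll|ll] := ltgtP Q.1 Q''.1.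
- have [|P stP Q''P] := IH Q SQ ll; first exact: cube_nested (ltW ll) Qx Q''x.
  by exists P => // y /Q'Q'' /Q''P.
- have [|P stP QP] := separated_below IH SQ ll.
    exact: cube_nested (ltW ll) Q''x Qx.
  case: (maxQ' P) => //; first by move=> y /sub /QP.
  by have := cube_level_le d_gt0 mu_leb QP; move: lt; lia.
- by exists Q' => //; rewrite (cube_set_eq ll Qx Q''x).
Qed.

Lemma sparse_selected : sparse mu 4^-1 [set Q | selected Q].
Proof.
have key Q Q' x : selected Q -> selected Q' -> Q.1 < Q'.1 ->
    sparse_part Q x -> sparse_part Q' x -> False.
  move=> SQ SQ' lt [Qx nQx] [Q'x _]; apply: nQx.
  have [P stP QP] := separated_selected SQ' SQ lt (cube_nested (ltW lt) Qx Q'x).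
  by exists P => //; exact: QP.
exists sparse_part; split=> [Q SQ|Q Q' SQ SQ' QQ'].
  split; [|by move=> x []|exact: mu_sparse_part].
  by apply: measurableD; [exact: measurable_cube|exact: measurable_cubes].
rewrite -subset0 => x [xQ xQ'].
have [ll|ll|ll] := ltgtP Q.1 Q'.1.
- exact: key ll xQ xQ'.
- exact: key ll xQ' xQ.
- by apply: QQ'; exact: cube_set_eq ll (proj1 xQ) (proj1 xQ').
Qed.

(** The first stopped cube on the chain below [Q] towards [x] is maximal, hence selected. *)
Lemma not_ctrl_between Q n x : selected Q -> cube_set R Q x ->
  (forall i, (0 < i < n)%N -> ~ selected (dcube_of (Q.1 + i%:Z) x)) ->
  forall i, (0 < i < n)%N -> ~ ctrl Q (dcube_of (Q.1 + i%:Z) x).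
Proof.
move=> SQ Qx nsel i ri ci.
suff : forall i, (0 < i < n)%N -> ~ stopped Q (dcube_of (Q.1 + i%:Z) x).
  apply; first exact: ri; split; last by left.
    by rewrite -{2}(dcube_of_eq Qx); apply: dcube_of_sub; lia.
  by rewrite /=; lia.
elim/ltn_ind=> {ri ci}i IH ri st; apply: (nsel i ri).
apply: selected_next SQ st _ => P' sub lt st'.
have [P'Q lP' _] := st'.
have P'x : cube_set R P' x by apply: sub; exact: mem_dcube_of.
rewrite /= in lt; apply: (IH (absz (P'.1 - Q.1))); try lia.
by rewrite (_ : Q.1 + _ = P'.1) ?dcube_of_eq //; lia.
Qed.

End Selection.

(** * Pointwise domination by the sparse sum *)

Section Domination.
Variables (R : realType) (d : nat) (mu : {measure set (d.-tuple R) -> \bar R}).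
Hypotheses (d_gt0 : (0 < d)%N) (mu_leb : is_lebesgue mu).
Variable f : d.-tuple R -> R.
Hypotheses (mf : measurable_fun setT f) (bf : exists M : R, forall x, `|f x| <= M).
Implicit Types (Q P : dcube d) (x y : d.-tuple R).

Section SparseSum.
Variable r : R.
Hypothesis r01 : 0 < r < 1.

Definition sparse_sum (S : set (dcube d)) x : \bar R :=
  (\esum_(Q in S) (Pquant mu r (cube_set R Q) (MQ mu f Q) *
    (\1_(cube_set R Q) x)%:E))%E.

Lemma sum_lam_le (S : set (dcube d)) x (a : int) n :
  ((\sum_(i < n | `[< S (dcube_of (a + i%:Z) x) >])
     lam mu f r (dcube_of (a + i%:Z) x))%:E <= sparse_sum S x)%E.
Proof.
pose q i := dcube_of (a + i%:Z) x.
pose l := [seq q i | i <- iota 0 n & `[< S (q i) >]].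
have ul : uniq l.
  rewrite map_inj_uniq ?filter_uniq ?iota_uniq // => i j.
  by move=> /(congr1 fst) /=; lia.
apply: esum_ge; exists [set` l].
  split; first exact: finite_seq.
  by move=> Q /= /mapP[i]; rewrite mem_filter => /andP[/asboolP Si _] ->.
rewrite -fsbig_seq // big_map big_filter -sumEFin.
rewrite -(big_mkord (fun i => `[< S (q i) >]) (fun i => (lam mu f r (q i))%:E)).
rewrite /index_iota subn0; apply: lee_sum => i _.
rewrite (PquantE_lam mu_leb mf bf r01) indicE mem_set ?mule1 //.
exact: mem_dcube_of.
Qed.

End SparseSum.

Variables (s t : nat) (K : R) (gen : int -> d.-tuple R -> R).
Hypothesis K_ge1 : 1 <= K.
Let v P := avg mu f P ^+ 2.
Hypothesis gen_cst : forall k x y,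
  dcube_of (k + s.+1%:Z) x = dcube_of (k + s.+1%:Z) y -> gen k x = gen k y.
Hypothesis gen_mean0 : forall P,
  cavg (fun c => gen (P.1 - s%:Z) (corner R c)) P = 0.
Hypothesis gen_osc : forall k x, gen k x ^+ 2 <=
  K * (iter t.+1 (@cavg R d) v (dcube_of k x) - iter t (@cavg R d) v (dcube_of k x)).

Let r := rquant R d t.
Let C := thresh d s K + K.
Let sel := selected R (bad mu f s t K gen).
Let r01 : 0 < r < 1 := rquant01 R d t.

Let C_ge1 : 1 <= C.
Proof.
have K1 := K_ge1; rewrite /C.
have : 0 <= thresh d s K by rewrite /thresh !mulr_ge0 ?exprn_ge0 //; lra.
by move=> ?; lra.
Qed.

Let not_bad_between := @not_ctrl_between R d d_gt0 (bad mu f s t K gen).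

(** Cut the chain at an intermediate selected cube and recurse on both pieces; when there is none,
    [psum_le] applies and the term [i = 0], which is [Q], pays. *)
Let psum_selected n Q x : sel Q -> cube_set R Q x ->
  `|psum gen Q n x| <= C * \sum_(i < n | `[< sel (dcube_of (Q.1 + i%:Z) x) >])
     lam mu f r (dcube_of (Q.1 + i%:Z) x).
Proof.
have C0 : 0 <= C by apply: le_trans C_ge1.
elim/ltn_ind: n Q => n IH Q SQ Qx.
have [[i /andP[i0 ni] Si]|nsel] := pselect (exists2 i, (0 < i < n)%N &
    sel (dcube_of (Q.1 + i%:Z) x)); last first.
  case: n IH nsel => [|n] IH nsel.
    by rewrite /psum !big_ord0 normr0 mulr0.
  apply: le_trans (psum_le d_gt0 mu_leb mf bf K_ge1 gen_osc Qx _) _.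
    apply: not_bad_between => // i ri Si; apply: nsel; by exists i.
  rewrite ler_wpM2l // (bigD1 ord0) /= ?addr0 ?dcube_of_eq //; last exact/asboolP.
  rewrite lerDl sumr_ge0 // => i _.
  exact: (lam_ge0 mu_leb mf bf r01).
have [k nk] : exists k, n = (i + k)%N by exists (n - i)%N; lia.
subst n.
have -> : psum gen Q (i + k) x =
    psum gen Q i x + psum gen (dcube_of (Q.1 + i%:Z) x) k x.
  rewrite /psum big_split_ord /=; congr (_ + _).
  by apply: eq_bigr => j _; rewrite PoszD addrA.
have -> : \sum_(j < i + k | `[< sel (dcube_of (Q.1 + j%:Z) x) >])
     lam mu f r (dcube_of (Q.1 + j%:Z) x) =
   \sum_(j < i | `[< sel (dcube_of (Q.1 + j%:Z) x) >])
     lam mu f r (dcube_of (Q.1 + j%:Z) x) +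
   \sum_(j < k | `[< sel (dcube_of (Q.1 + i%:Z + j%:Z) x) >])
     lam mu f r (dcube_of (Q.1 + i%:Z + j%:Z) x).
  rewrite big_mkcond big_split_ord /= -big_mkcond; congr (_ + _).
  by rewrite [RHS]big_mkcond; apply: eq_bigr => j _; rewrite PoszD addrA.
rewrite mulrDr; apply: le_trans (ler_normD _ _) _; apply: lerD.
  exact: IH.
by apply: IH Si _; [lia|exact: mem_dcube_of].
Qed.

Let avg_selected n Q x : sel Q -> cube_set R Q x ->
  exists2 P, sel P /\ cube_set R P x &
    `|avg mu f (dcube_of (Q.1 + n%:Z) x)| <= lam mu f r P.
Proof.
elim/ltn_ind: n Q => n IH Q SQ Qx.
(* The range includes the end cube [i = n]: if selected, it controls its own average. *)
have [[i /andP[i0 ni] Si]|nsel] := pselect (exists2 i, (0 < i < n.+1)%N &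
    sel (dcube_of (Q.1 + i%:Z) x)); last first.
  exists Q => //; apply: (avg_le (s := s) (gen := gen) d_gt0 mu_leb mf bf K_ge1) => // i.
  by apply: not_bad_between => // {}i ri Si; apply: nsel; exists i.
have [|P SP] := IH (n - i)%N _ _ Si (mem_dcube_of _ _); first by lia.
rewrite /= -addrA -PoszD subnKC; last by lia.
by exists P.
Qed.

Lemma sparse_domination : exists S : set (dcube d), [/\ sparse mu 4^-1 S,
  forall x, exists N : nat, forall m n : nat, (N <= m)%N ->
    ((\sum_(i < n) gen (- m%:Z + i%:Z) x)%:E <= C%:E * sparse_sum r S x)%E &
  forall x, (MD mu f x <= sparse_sum r S x)%E].
Proof.
exists [set Q | sel Q]; split=> [|x|x].
- by apply: sparse_selected => // Q; exact: mu_bad.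
(* For [m >= N] the cube of generation [-m] containing [x] touches the origin, so the sum starts at
   a selected cube. *)
- have [N top] := touches0_dcube_of x; exists N => m n Nm.
  have S0 : sel (dcube_of (- m%:Z) x) by apply: selected_top; exact: top.
  have h := psum_selected n S0 (mem_dcube_of _ _).
  apply: (@le_trans _ _ (C%:E * (\sum_(i < n | `[< sel (dcube_of (- m%:Z + i%:Z) x) >])
     lam mu f r (dcube_of (- m%:Z + i%:Z) x))%:E)%E).
    by rewrite -EFinM lee_fin; apply: le_trans h; exact: ler_norm.
  apply: lee_wpmul2l; first by rewrite lee_fin; apply: le_trans C_ge1.
  exact: sum_lam_le.
- have [N top] := touches0_dcube_of x.
  apply: ge_ereal_sup => _ [Q Qx <-].
  pose m := (N + absz Q.1)%N.
  have S0 : sel (dcube_of (- m%:Z) x) by apply: selected_top; apply: top; exact: leq_addr.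
  have [P [SP Px]] := avg_selected (absz (Q.1 + m%:Z)) S0 (mem_dcube_of _ _).
  rewrite /= (_ : - m%:Z + _ = Q.1); last by rewrite /m; lia.
  rewrite dcube_of_eq // => QP.
  apply: (@le_trans _ _ (lam mu f r P)%:E); first by rewrite lee_fin.
  apply: le_trans (sum_lam_le r01 _ x P.1 1).
  rewrite big_mkcond big_ord_recl big_ord0 /= !addr0 dcube_of_eq //.
  by rewrite asboolT.
Qed.

End Domination.

(** * Reduction to partial sums; martingale transforms and the maximal operator *)

Section PartialSums.
Variables (R : realType) (d : nat) (mu : {measure set (d.-tuple R) -> \bar R}).
Hypotheses (d_gt0 : (0 < d)%N) (mu_leb : is_lebesgue mu).
Implicit Types (f : d.-tuple R -> R) (Q P : dcube d) (x y : d.-tuple R).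

Definition avg_sqr f P : R := avg mu f P ^+ 2.

(** The variance of the averages over the children of [P], by [osc_mean]. *)
Definition osc f P : R := cavg (avg_sqr f) P - avg_sqr f P.

Lemma Linfc_measurable f : Linfc f -> measurable_fun setT f.
Proof. by case. Qed.

Lemma Linfc_bounded f : Linfc f -> exists M : R, forall x, `|f x| <= M.
Proof. by case. Qed.

Lemma limn_esup_le (u : nat -> \bar R) (l : \bar R) (N : nat) :
  (forall n, (N <= n)%N -> (u n <= l)%E) -> (limn_esup u <= l)%E.
Proof.
move=> ul; rewrite limn_esup_lim; apply: lime_le; first exact: is_cvg_esups.
exists N => // n /= Nn; apply: ge_ereal_sup => _ [m /= nm <-].
by apply: ul; exact: leq_trans nm.
Qed.

(** The domination holds for every sum starting at a sufficiently coarse scale, hence for the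
    limsup; the offset [c] absorbs a reindexing of generations. *)
Lemma sparse_dominated_partial_sums (s t : nat) (K : R)
    (G : (d.-tuple R -> R) -> int -> d.-tuple R -> R) (c : nat)
    (T : (d.-tuple R -> R) -> d.-tuple R -> \bar R) :
  1 <= K ->
  (forall f k x y, dcube_of (k + s.+1%:Z) x = dcube_of (k + s.+1%:Z) y ->
     G f k x = G f k y) ->
  (forall f P, Linfc f -> cavg (fun b => G f (P.1 - s%:Z) (corner R b)) P = 0) ->
  (forall f k x, Linfc f ->
     G f k x ^+ 2 <= K * iter t (@cavg R d) (osc f) (dcube_of k x)) ->
  (forall f x, T f x = limn_esup (fun N =>
     (\sum_(i < (2 * N).+1) G f (- (N + c)%N%:Z + i%:Z) x)%:E)) ->
  sparse_dominated mu T.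
Proof.
move=> K1 Gcst Gmean Gosc TE; exists (rquant R d t).
split; first exact: rquant01.
exists 4^-1; split; first by apply/andP; split; lra.
have th0 : 0 <= thresh d s K by rewrite /thresh !mulr_ge0 ?exprn_ge0 //; lra.
exists (thresh d s K + K); split; first by lra.
move=> f Lf.
have [|S [sS dom _]] := @sparse_domination R d mu d_gt0 mu_leb f (Linfc_measurable Lf)
  (Linfc_bounded Lf) s t K (G f) K1 (Gcst f) (fun P => Gmean f P Lf).
  move=> k x; apply: le_trans (Gosc f k x Lf) _.
  rewrite ler_wpM2l //; first by lra.
  rewrite iterSr -[X in X - _]mul1r -mulN1r -iter_cavg_lin.
  by apply: iter_cavg_le => P _ _; rewrite mul1r mulN1r.
exists S; split=> //; apply: aeW => x; rewrite TE.
have [N h] := dom x; apply: (@limn_esup_le _ _ N) => n Nn.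
by apply: h; exact: leq_trans (leq_addr _ _).
Qed.

Lemma avg_mean f P : Linfc f -> avg mu f P = cavg (avg mu f) P.
Proof. by move=> [? ? _]; exact: avg_children. Qed.

Lemma osc_mean f P : Linfc f ->
  osc f P = cavg (fun c => (avg mu f c - avg mu f P) ^+ 2) P.
Proof.
move=> Lf; set m := avg mu f P.
have mE : m = cavg (avg mu f) P by exact: avg_mean.
have -> : cavg (fun c => (avg mu f c - m) ^+ 2) P =
    cavg (fun c => 1 * avg_sqr f c + 1 * (- (2 * m) * avg mu f c + m ^+ 2 * 1)) P.
  by congr (_ * _); apply: eq_bigr => a _; rewrite /avg_sqr; ring.
rewrite !cavg_lin cavg_cst -mE /osc /avg_sqr -/m; ring.
Qed.

Lemma osc_ge0 f P : Linfc f -> 0 <= osc f P.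
Proof.
move=> Lf; rewrite osc_mean // (iter_cavg_ge0 1) // => c; exact: sqr_ge0.
Qed.

Lemma sum_sqr_osc f P : Linfc f ->
  \sum_(a : d.-tuple 'I_(2 ^ 1)) (avg mu f (subcube P a) - avg mu f P) ^+ 2 =
  2 ^+ d * osc f P.
Proof. by move=> Lf; rewrite osc_mean // /cavg mulVKf // expf_neq0 ?pnatr_eq0. Qed.

Lemma sqr_child_osc f P (a : d.-tuple 'I_(2 ^ 1)) : Linfc f ->
  (avg mu f (subcube P a) - avg mu f P) ^+ 2 <= 2 ^+ d * osc f P.
Proof.
move=> Lf; rewrite -sum_sqr_osc // (bigD1 a) //= lerDl sumr_ge0 // => b _.
exact: sqr_ge0.
Qed.

Lemma sparse_dominated_mart_transform sigma : mt_multiplier sigma ->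
  sparse_dominated mu (mart_transform mu sigma).
Proof.
move=> [scst s1].
(* The difference is indexed by its coarser generation, on whose cubes the multiplier is constant;
   hence [s = 0] and the offset 1. *)
pose G f (k : int) x := sigma (k + 1) x * (Ek mu f (k + 1) x - Ek mu f k x).
have sc k x y : dcube_of k x = dcube_of k y -> sigma (k + 1) x = sigma (k + 1) y.
  by move=> xy; apply: scst; rewrite addrK.
apply: (@sparse_dominated_partial_sums 0 0 (2 ^+ d) G 1).
- by rewrite exprn_ege1 // ler1n.
- move=> f k x y xy; have xy' : dcube_of k x = dcube_of k y.
    by apply: dcube_of_coarse xy; lia.
  by rewrite /G /Ek (sc _ _ _ xy') xy' xy.
- move=> f P Lf; rewrite subr0.
  have -> : cavg (fun b => G f P.1 (corner R b)) P =
      cavg (fun b => sigma (P.1 + 1) (corner R P) * avg mu f b +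
        - (sigma (P.1 + 1) (corner R P) * avg mu f P) * 1) P.
    congr (_ * _); apply: eq_bigr => a _.
    have cP : dcube_of P.1 (corner R (subcube P a)) = P.
      by apply: dcube_of_eq; exact: subcube_sub (mem_corner R _).
    have cc : dcube_of (P.1 + 1) (corner R (subcube P a)) = subcube P a.
      by rewrite -[RHS](dcube_of_eq (mem_corner R _)).
    rewrite /G /Ek cP cc (sc P.1 _ (corner R P)); first by ring.
    by rewrite cP dcube_of_eq //; exact: mem_corner.
  rewrite cavg_lin cavg_cst.
  rewrite -avg_mean //; ring.
- move=> f k x Lf /=; rewrite /G exprMn.
  have [a ea] := dcube_of_subcube k 1 x.
  rewrite /Ek ea; apply: le_trans (sqr_child_osc _ _ Lf).
  apply: ler_piMl; first exact: sqr_ge0.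
  by rewrite -[leLHS]ger0_norm ?sqr_ge0 // normrX exprn_ile1.
- move=> f x; congr limn_esup; apply/funext => N; congr _%:E.
  apply: eq_bigr => i _; rewrite /G /=.
  rewrite (_ : - (N + 1)%N%:Z + i%:Z + 1 = i%:Z - N%:Z); last by lia.
  by rewrite (_ : - (N + 1)%N%:Z + i%:Z = i%:Z - N%:Z - 1); last by lia.
Qed.

Lemma sparse_dominated_MD : sparse_dominated mu (MD mu).
Proof.
exists (rquant R d 0); split; first exact: rquant01.
exists 4^-1; split; first by apply/andP; split; lra.
exists 1; split=> // f Lf.
(* With a zero operator the selection tracks the averages only. *)
have [||||S [sS _ dom]] := @sparse_domination R d mu d_gt0 mu_leb f
  (Linfc_measurable Lf) (Linfc_bounded Lf) 0 0 1 (fun _ _ => 0).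
- by [].
- by [].
- by move=> P; rewrite cavg_cst.
- move=> k x; rewrite expr0n mul1r; exact: osc_ge0.
- by exists S; split=> //; apply: aeW => x; rewrite mul1e.
Qed.

End PartialSums.

(** * Haar functions and Haar shifts *)

Section HaarShift.
Variables (R : realType) (d : nat) (mu : {measure set (d.-tuple R) -> \bar R}).
Hypotheses (d_gt0 : (0 < d)%N) (mu_leb : is_lebesgue mu).
Variable h : dcube d -> 'I_(2 ^ d).-1 -> d.-tuple R -> R.
Hypothesis haar : haar_system mu h.
Implicit Types (f g : d.-tuple R -> R) (Q P S T : dcube d) (x y : d.-tuple R).

Let child_const g Q (a : d.-tuple 'I_(2 ^ 1)) (u : R) :
  (forall x, cube_set R (subcube Q a) x -> g x = u) ->
  Rintegral mu (cube_set R (subcube Q a)) g = u * vol R (subcube Q a).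
Proof.
move=> gu; rewrite (@eq_Rintegral _ _ _ _ _ (fun=> u)); last first.
  by move=> x; rewrite inE => /gu.
by rewrite Rintegral_cst ?mu_cube //; exact: measurable_cube.
Qed.

Let Rintegral_support g Q : measurable_fun setT g ->
  (exists M : R, forall x, `|g x| <= M) -> (forall x, ~ cube_set R Q x -> g x = 0) ->
  Rintegral mu setT g =
  \sum_(a : d.-tuple 'I_(2 ^ 1)) Rintegral mu (cube_set R (subcube Q a)) g.
Proof.
move=> mg bg g0; rewrite -(Rintegral_children mu_leb mg bg) [RHS]Rintegral_mkcond.
congr Rintegral; apply/funext => x; rewrite patchE.
by case: ifPn => // /negP; rewrite inE => /g0.
Qed.

Definition haar_val Q e (a : d.-tuple 'I_(2 ^ 1)) : R :=
  h Q e (corner R (subcube Q a)).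

Lemma haar_measurable Q e : measurable_fun setT (h Q e).
Proof. by have [] := haar Q e. Qed.

Lemma haar_out Q e x : ~ cube_set R Q x -> h Q e x = 0.
Proof. by have [_ + _ _ _] := haar Q e; apply. Qed.

Lemma haar_child Q e (a : d.-tuple 'I_(2 ^ 1)) x :
  cube_set R (subcube Q a) x -> h Q e x = haar_val Q e a.
Proof.
by have [_ _ hc _ _] := haar Q e => xa; apply: hc xa _; exact: mem_corner.
Qed.

Lemma haar_bounded Q e : exists M : R, forall x, `|h Q e x| <= M.
Proof.
exists (\sum_(a : d.-tuple 'I_(2 ^ 1)) `|haar_val Q e a|) => x.
have [Qx|nQx] := pselect (cube_set R Q x); last first.
  by rewrite haar_out // normr0 sumr_ge0.
have [a xa] := subcube_cover 1 Qx; rewrite (haar_child e xa).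
by rewrite (bigD1 a) //= lerDl sumr_ge0.
Qed.

Let childvol Q : R := (2 ^+ d)^-1 * vol R Q.

Let vol_child Q (a : d.-tuple 'I_(2 ^ 1)) : vol R (subcube Q a) = childvol Q.
Proof. by rewrite /childvol (vol_subcube R Q a) expr1 mulKf // expf_neq0 ?pnatr_eq0. Qed.

Let childvol_gt0 Q : 0 < childvol Q.
Proof. by rewrite mulr_gt0 ?vol_gt0 // invr_gt0 exprn_gt0. Qed.

Lemma haar_val_sum Q e : \sum_(a : d.-tuple 'I_(2 ^ 1)) haar_val Q e a = 0.
Proof.
have [_ _ _ + _] := haar Q e.
rewrite (Rintegral_children mu_leb (haar_measurable Q e) (haar_bounded Q e)).
under eq_bigr => a _ do rewrite (child_const (@haar_child Q e a)) vol_child.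
rewrite -mulr_suml => /eqP; rewrite mulf_eq0 => /orP[/eqP //|].
by rewrite gt_eqF // childvol_gt0.
Qed.

Lemma haar_val_sqr Q e :
  (\sum_(a : d.-tuple 'I_(2 ^ 1)) haar_val Q e a ^+ 2) * childvol Q = 1.
Proof.
have [_ _ _ _ /(_ e)] := haar Q e; rewrite eqxx => hQ.
rewrite -[RHS]/(true%:R) -hQ => {hQ}.
have [M hM] := haar_bounded Q e.
rewrite (@Rintegral_support _ Q).
- rewrite mulr_suml; apply: eq_bigr => a _; rewrite -(vol_child Q a) expr2.
  by symmetry; apply: child_const => x /haar_child ->.
- by apply: measurable_funM; exact: haar_measurable.
- exists (M * M) => x; rewrite normrM; apply: ler_pM => //.
- by move=> x /haar_out ->; rewrite mul0r.
Qed.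

Lemma haar_sqr_le Q e x : h Q e x ^+ 2 * childvol Q <= 1.
Proof.
have [Qx|nQx] := pselect (cube_set R Q x); last first.
  by rewrite haar_out // expr0n mul0r.
have [a xa] := subcube_cover 1 Qx; rewrite (haar_child e xa) -(haar_val_sqr Q e).
rewrite ler_wpM2r //; first exact: ltW.
by rewrite (bigD1 a) //= lerDl sumr_ge0 // => b _; exact: sqr_ge0.
Qed.

(** Since [h Q e] has mean zero, the average of [f] on [Q] can be subtracted; the coefficient then
    sees only the oscillation. *)
Lemma haar_coef f Q e : Linfc f ->
  Rintegral mu setT (fun y => f y * h Q e y) =
  (\sum_(a : d.-tuple 'I_(2 ^ 1))
     haar_val Q e a * (avg mu f (subcube Q a) - avg mu f Q)) * childvol Q.
Proof.
move=> Lf; have [mf [Mf fM] _] := Lf; have [M hM] := haar_bounded Q e.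
rewrite (@Rintegral_support _ Q).
- under [in RHS]eq_bigr do rewrite mulrBr.
  rewrite sumrB -[X in _ - X]mulr_suml haar_val_sum mul0r subr0 mulr_suml.
  apply: eq_bigr => a _; rewrite -(vol_child Q a) -mulrA.
  rewrite -(Rintegral_avg mu_leb) -RintegralZl.
  + by apply: eq_Rintegral => x; rewrite inE => /haar_child ->; rewrite mulrC.
  + exact: measurable_cube.
  + by apply: integrable_cube => //; exists Mf.
- by apply: measurable_funM => //; exact: haar_measurable.
- by exists (Mf * M) => x; rewrite normrM; apply: ler_pM.
- by move=> x /haar_out ->; rewrite mulr0.
Qed.

(** Expand the sum of the squares of [A * q i - B * p i], which is [A * (A * D - B ^+ 2)]. *)
Lemma cauchy_schwarz_sum (I : finType) (p q : I -> R) :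
  (\sum_i p i * q i) ^+ 2 <= (\sum_i p i ^+ 2) * (\sum_i q i ^+ 2).
Proof.
set A := \sum_i p i ^+ 2; set B := \sum_i p i * q i; set D := \sum_i q i ^+ 2.
have A0 : 0 <= A by apply: sumr_ge0 => i _; exact: sqr_ge0.
have : 0 <= \sum_i (A * q i - B * p i) ^+ 2.
  by apply: sumr_ge0 => i _; exact: sqr_ge0.
have -> : \sum_i (A * q i - B * p i) ^+ 2 =
    A ^+ 2 * D - 2 * A * B * B + B ^+ 2 * A.
  transitivity (\sum_i (A ^+ 2 * q i ^+ 2 - 2 * A * B * (p i * q i) + B ^+ 2 * p i ^+ 2)).
    by apply: eq_bigr => i _; ring.
  by rewrite big_split sumrB /= -!mulr_sumr.
have [A1|A1] := eqVneq A 0.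
  move=> _; have p0 i : p i = 0.
    apply/eqP; rewrite -sqrf_eq0; apply/eqP.
    by apply: (@psumr_eq0P _ _ xpredT (fun i => p i ^+ 2)) => // j _; exact: sqr_ge0.
  rewrite /B big1 => [|i _]; last by rewrite p0 mul0r.
  by rewrite expr0n mulr_ge0 //; apply: sumr_ge0 => i _; exact: sqr_ge0.
have {}A1 : 0 < A by rewrite lt_neqAle eq_sym A1.
rewrite (_ : _ + _ = A * (A * D - B ^+ 2)); last by ring.
by rewrite pmulr_rge0 // subr_ge0.
Qed.

Lemma haar_coef_sqr f Q e : Linfc f ->
  Rintegral mu setT (fun y => f y * h Q e y) ^+ 2 <=
  2 ^+ d * osc mu f Q * childvol Q.
Proof.
move=> Lf; rewrite haar_coef // exprMn expr2 mulrA ler_pM2r ?childvol_gt0 //.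
rewrite -ler_pdivlMr ?childvol_gt0 //.
apply: le_trans (cauchy_schwarz_sum _ _) _.
rewrite -[X in X * _](mulfK (lt0r_neq0 (childvol_gt0 Q))) haar_val_sqr mul1r.
by rewrite sum_sqr_osc // mulrC.
Qed.

Lemma haar_cst S e x y : dcube_of (S.1 + 1) x = dcube_of (S.1 + 1) y ->
  h S e x = h S e y.
Proof.
move=> xy; have xy' : dcube_of S.1 x = dcube_of S.1 y.
  by apply: dcube_of_coarse xy; lia.
have [Sx|nSx] := pselect (cube_set R S x).
  have [a xa] := subcube_cover 1 Sx; rewrite (haar_child e xa) (@haar_child S e a) //.
  by apply/cube_setE; rewrite -[RHS](dcube_of_eq xa) /= xy.
rewrite !haar_out // => Sy; apply: nSx; apply/cube_setE; rewrite xy'.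
exact: dcube_of_eq.
Qed.

Lemma haar_mean0 S e P : S.1 = P.1 -> cavg (fun c => h S e (corner R c)) P = 0.
Proof.
move=> SP; have [->|nSP] := eqVneq S P.
  by rewrite /cavg [X in _ * X]haar_val_sum mulr0.
rewrite /cavg big1 ?mulr0 // => a _; apply: haar_out => Sc.
by move/eqP: nSP; apply; apply: cube_set_eq SP Sc _; exact: subcube_sub (mem_corner R _).
Qed.

Let cavg_sum0 (I : finType) (F : I -> dcube d -> R) P :
  (forall i, cavg (F i) P = 0) -> cavg (fun c => \sum_i F i c) P = 0.
Proof.
move=> F0; rewrite /cavg exchange_big mulr_sumr big1 // => i _; exact: F0.
Qed.

Lemma sparse_dominated_haar_shift (t s : nat) alpha :
  (exists B : R, forall Q T S e e', `|alpha Q T S e e'| <= B) ->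
  sparse_dominated mu (haar_shift mu t s h alpha).
Proof.
move=> [B0 alphaB0].
have [B B_ge0 alphaB] : exists2 B : R, 0 <= B &
    forall Q T S e e', `|alpha Q T S e e'| <= B.
  by exists `|B0| => // Q T S e e'; apply: le_trans (ler_norm _); exact: alphaB0.
pose M : R := \sum_(a : d.-tuple 'I_(2 ^ t)) \sum_(b : d.-tuple 'I_(2 ^ s))
  \sum_(e : 'I_(2 ^ d).-1) \sum_(e' : 'I_(2 ^ d).-1) 1.
(* One factor [2 ^+ d] comes from [haar_coef_sqr], [t] from bounding the oscillation on one cube by
   the mean, and [s] from comparing the volumes of the two descendants; [M] counts the terms. *)
pose z : R := (2 ^+ d) ^+ (t + s.+1).
pose K : R := Num.max 1 ((B * M) ^+ 2 * z).
apply: (@sparse_dominated_partial_sums R d mu d_gt0 mu_leb s t K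
  (shift_gen mu t s h alpha) 0).
- by rewrite le_max lexx.
- move=> f k x y xy; rewrite /shift_gen.
  rewrite (_ : dcube_of k x = dcube_of k y); last first.
    by apply: dcube_of_coarse xy; lia.
  do 4 (apply: eq_bigr => ? _); congr (_ * _); apply: haar_cst.
  by rewrite /= -addrA -PoszD addn1.
- move=> f P Lf; set k := P.1 - s%:Z.
  pose P' := dcube_of k (corner R P).
  have -> : cavg (fun c => shift_gen mu t s h alpha f k (corner R c)) P =
      cavg (fun c => \sum_(a : d.-tuple 'I_(2 ^ t)) \sum_(b : d.-tuple 'I_(2 ^ s))
        \sum_(e : 'I_(2 ^ d).-1) \sum_(e' : 'I_(2 ^ d).-1)
        alpha P' (subcube P' a) (subcube P' b) e e' *
        Rintegral mu setT (fun y => f y * h (subcube P' a) e y) *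
        h (subcube P' b) e' (corner R c)) P.
    congr (_ * _); apply: eq_bigr => c _; rewrite /shift_gen.
    rewrite (_ : dcube_of k (corner R (subcube P c)) = P') //.
    apply: (@dcube_of_coarse R d k P.1); first by rewrite /k; lia.
    rewrite !dcube_of_eq //; first exact: mem_corner.
    exact: subcube_sub (mem_corner R _).
  do 4 (apply: cavg_sum0 => ?).
  rewrite /cavg -mulr_sumr mulrCA [X in _ * X]haar_mean0 ?mulr0 //.
  by rewrite /= /k subrK.
- move=> f k x Lf; set P := dcube_of k x; set O := iter _ _ _ P.
  have osc0 T : 0 <= osc mu f T by exact: osc_ge0.
  have O0 : 0 <= O by exact: iter_cavg_ge0.
  have z0 : 0 <= z by rewrite !exprn_ge0.
  have term a b e e' :
      `|alpha P (@subcube d P t a) (@subcube d P s b) e e' *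
        Rintegral mu setT (fun y => f y * h (subcube P a) e y) *
        h (subcube P b) e' x| <= B * Num.sqrt (z * O).
    rewrite -mulrA normrM; apply: ler_pM => //.
    rewrite -sqrtr_sqr; apply: ler_wsqrtr; rewrite exprMn.
    have oscO : osc mu f (subcube P a) <= (2 ^+ d) ^+ t * O.
      have := @iter_cavg_ge_point R d t _ P (corner R (subcube P a)) osc0
        (subcube_sub (mem_corner R _)).
      by rewrite -[P.1 + t%:Z]/(subcube P a).1 dcube_of_eq //; exact: mem_corner.
    have c0 := childvol_gt0 (subcube P b).
    have volT : childvol (subcube P a) <= (2 ^+ d) ^+ s * childvol (subcube P b).
      rewrite /childvol mulrCA -vol_subcube ler_pM2l ?invr_gt0 ?exprn_gt0 //.
      rewrite (vol_subcube R P a) ler_peMl ?exprn_ege1 ?ler1n //.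
      exact/ltW/vol_gt0.
    (* Multiplying by the child volume of the output cube makes the normalization [haar_sqr_le]
       applicable. *)
    rewrite -(ler_pM2r c0) -mulrA.
    apply: (@le_trans _ _ (2 ^+ d * osc mu f (subcube P a) * childvol (subcube P a) * 1)).
      apply: ler_pM; [exact: sqr_ge0| |exact: haar_coef_sqr|exact: haar_sqr_le].
      by apply: mulr_ge0; [exact: sqr_ge0|exact: ltW].
    rewrite mulr1 /z exprD exprS.
    apply: (@le_trans _ _ (2 ^+ d * ((2 ^+ d) ^+ t * O) *
        ((2 ^+ d) ^+ s * childvol (subcube P b)))).
      apply: ler_pM => //; first by rewrite mulr_ge0 // exprn_ge0.
        exact/ltW/childvol_gt0.
      by rewrite ler_pM2l ?exprn_gt0.
    rewrite le_eqVlt; apply/orP; left; apply/eqP.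
    by move: (childvol _) (2 ^+ d) => cv w; ring.
  have le : `|shift_gen mu t s h alpha f k x| <= M * (B * Num.sqrt (z * O)).
    rewrite /shift_gen -/P /M !mulr_suml.
    do 4 (apply: le_trans (ler_norm_sum _ _ _) _; rewrite ?mulr_suml;
      apply: ler_sum => ? _).
    by rewrite mul1r.
  have M0 : 0 <= M by do 4 (apply: sumr_ge0 => ? _).
  rewrite -[leLHS]ger0_norm ?sqr_ge0 // normrX.
  apply: (@le_trans _ _ ((M * (B * Num.sqrt (z * O))) ^+ 2)).
    by rewrite ler_pXn2r ?nnegrE // !mulr_ge0 // sqrtr_ge0.
  rewrite mulrA exprMn sqr_sqrtr ?mulr_ge0 // mulrA (mulrC M).
  by rewrite ler_wpM2r // /K le_max lexx orbT.
- move=> f x; congr limn_esup; apply/funext => N; congr _%:E.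
  by apply: eq_bigr => i _; rewrite addn0 addrC.
Qed.

End HaarShift.

Theorem theoremA (R : realType) (d : nat) (mu : {measure set (d.-tuple R) -> \bar R}) :
  (0 < d)%N -> is_lebesgue mu ->
  [/\ (* dyadic martingale transforms *)
      forall sigma : int -> d.-tuple R -> R, mt_multiplier sigma ->
        sparse_dominated mu (mart_transform mu sigma),
      (* Haar shifts of complexity (t, s) *)
      forall (t s : nat) (h : dcube d -> 'I_(2 ^ d).-1 -> d.-tuple R -> R)
        (alpha : dcube d -> dcube d -> dcube d -> 'I_(2 ^ d).-1 -> 'I_(2 ^ d).-1 -> R),
        haar_system mu h ->
        (exists B : R, forall Q T S e e', `|alpha Q T S e e'| <= B) ->
        sparse_dominated mu (haar_shift mu t s h alpha) &
      (* the dyadic maximal operator *)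
      sparse_dominated mu (MD mu)].
Proof.
move=> d_gt0 mu_leb; split.
- by move=> sigma; exact: sparse_dominated_mart_transform.
- by move=> t s h alpha haar; exact: sparse_dominated_haar_shift.
- exact: sparse_dominated_MD.
Qed.
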